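(* Let $1<p<\infty$ and let $g=(g_k)_{k\ge1}$ be a complex sequence. The operator $H_{g,0}$ is bounded on the Hardy–Littlewood space $\mathcal{HL}^p$ if and only if $\sup_{n\in\mathbb N} G(n;(2^j);g)<\infty$, in which case $$\|H_{g,0}\|_{\mathcal{HL}^p\to\mathcal{HL}^p}\asymp\sup_{n\in\mathbb N} G(n;(2^j);g)^{\frac1p},$$ with implied constants independent of $g$. Moreover, let $d=(d_n)_{n\ge0}$ be a strictly increasing sequence of positive integers with $d_0=1$. (i) If $\lim_{k\to\infty} d_k/d_{k-1}=1$ and the limit $\lim_{n\to\infty}G(n;d;g)$ exists in $[0,\infty)$, then $$\|H_{g,0}\|_{e,\mathcal{HL}^p\to\mathcal{HL}^p}=\frac{\pi}{\sin\left(\frac{\pi}{p}\right)}\left(\lim_{n\to\infty}G(n;d;g)\right)^{\frac1p}.$$ (ii) If $\lim_{k\to\infty} d_k/d_{k-1}>1$, then there exists no function $F\colon[0,\infty)^{\mathbb N}\to[0,\infty)$ such that $$\|H_{g,0}\|_{e,\mathcal{HL}^p\to\mathcal{HL}^p}=F\big((G(n;d;g))_{n\in\mathbb N}\big)$$ for all complex sequences $g$ for which $H_{g,0}$ is bounded on $\mathcal{HL}^p$.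
   Context: Here $\mathbb N=\{1,2,\dots\}$. The Hardy–Littlewood space $\mathcal{HL}^p$ is the space of complex sequences $a=(a_n)_{n\ge1}$ with finite norm $$\|a\|_{\mathcal{HL}^p}:=\left(\sum_{n=1}^\infty|a_n|^p n^{p-2}\right)^{\frac1p}.$$ The operator $H_{g,0}$ maps $a=(a_n)$ to the sequence whose $k$-th entry ($k\in\mathbb N$) is $\sum_{n=1}^\infty\frac{g_k a_n}{n+k}$. For a strictly increasing sequence $d=(d_n)_{n\ge0}$ of positive integers with $d_0=1$, and $n\in\mathbb N$, $$G(n;d;g):=\frac1{d_n-d_{n-1}}\sum_{k=d_{n-1}}^{d_n-1}|g_k|^p ;$$ $G(n;(2^j);g)$ denotes this quantity for $d_j=2^j$. The essential norm of a bounded operator $S\colon\mathcal{HL}^p\to\mathcal{HL}^p$ is $\|S\|_{e,\mathcal{HL}^p\to\mathcal{HL}^p}:=\inf_T\|S-T\|_{\mathcal{HL}^p\to\mathcal{HL}^p}$, the infimum being over all compact operators $T$ on $\mathcal{HL}^p$. The notation $X\asymp Y$, with implied constants independent of $g$, means that there are constants $c,C>0$ not depending on $g$ (they may depend on $p$) with $cY\le X\le CY$. *)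

(* Defs.v *)
From HB Require Import structures.
From mathcomp Require Import all_boot all_order all_algebra.
From mathcomp Require Import complex.
From mathcomp Require Import all_classical all_reals all_analysis.

Set Implicit Arguments.
Unset Strict Implicit.
Unset Printing Implicit Defensive.
Import Order.TTheory GRing.Theory Num.Theory.
Import numFieldNormedType.Exports.

Local Open Scope classical_set_scope.
Local Open Scope ring_scope.

(* All sequences indexed by {1, 2, ...} are stored with a shift by one:
   the entry a_n of a sequence a is [a n.-1], for n >= 1.
   The scalars are R[i]^o, i.e. R[i] seen as a normed module over itself, since
   the library puts no topology on the bare type R[i]. *)

Definition HLnorm (R : realType) (p : R) (a : nat -> R[i]^o) : \bar R :=
  ((\sum_(0 <= n <oo)
      (Normc.normc (a n) `^ p * n.+1%:R `^ (p - 2))%:E) `^ p^-1)%E.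

Definition HLpred (R : realType) (p : R) : {pred nat -> R[i]^o} :=
  fun a => (HLnorm p a < +oo)%E.

(* The proof [p1] is a phantom parameter on which the instances below depend. *)
Record HL (R : realType) (p : R) (p1 : 1 < p) : Type := MkHL {
  HLseq :> nat -> R[i]^o;
  HLseqP : HLseq \in HLpred p }.

Section HL_normed_module.
Context (R : realType) (p : R) (p1 : 1 < p).
Implicit Types a b : nat -> R[i]^o.

Let p0 : 0 < p. Proof. exact: lt_trans p1. Qed.
Let pi0 : 0 <= p^-1. Proof. by rewrite invr_ge0 ltW. Qed.
Let pn0 : p != 0. Proof. by rewrite gt_eqF. Qed.

HB.instance Definition _ := [isSub for @HLseq R p p1].
HB.instance Definition _ := [Choice of HL p1 by <:].

Let term a n : R := Normc.normc (a n) `^ p * n.+1%:R `^ (p - 2).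

Let term_ge0 a n : (0 <= (term a n)%:E)%E.
Proof. by rewrite lee_fin mulr_ge0 ?powR_ge0. Qed.

Let normc_ge0 (z : R[i]) : 0 <= Normc.normc z.
Proof. by case: z => x y; exact: sqrtr_ge0. Qed.

Let wf a n : R := Normc.normc (a n) * n.+1%:R `^ ((p - 2) / p).

Let wf_ge0 a n : 0 <= wf a n.
Proof. by rewrite mulr_ge0 ?powR_ge0. Qed.

Let wfE a n : wf a n `^ p = term a n.
Proof. by rewrite powRM ?powR_ge0// -powRrM divfK. Qed.

Let HLnormE a : HLnorm p a = ('N[counting]_p%:E[EFin \o wf a])%E.
Proof.
rewrite Lnorm_counting//; congr (_ `^ _)%E; apply: eq_eseriesr => n _ /=.
by rewrite ger0_norm// wfE.
Qed.

Lemma HLnorm_ge0 a : (0 <= HLnorm p a)%E.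
Proof. exact: poweR_ge0. Qed.

Lemma ler_HLnormD a b : (HLnorm p (a + b)%R <= HLnorm p a + HLnorm p b)%E.
Proof.
rewrite [in leRHS]HLnormE [X in (_ + X)%E]HLnormE.
apply: le_trans; last by apply: minkowski_EFin => //; exact: ltW.
rewrite Lnorm_counting//.
apply: gt0_ler_poweR => //; rewrite ?in_itv/= ?leey ?andbT.
- by apply: nneseries_ge0 => n _ _; exact: term_ge0.
- by apply: nneseries_ge0 => n _ _; rewrite lee_fin powR_ge0.
apply: lee_nneseries => [n _ _|n _ /=]; first exact: term_ge0.
rewrite -/(term _ _) -wfE lee_fin.
have le : wf (a + b) n <= `|wf a n + wf b n|.
  rewrite ger0_norm ?addr_ge0// -mulrDl ler_wpM2r ?powR_ge0//.
  exact: le_normcD.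
by apply: (ge0_ler_powR (ltW p0) _ _ le); rewrite nnegrE.
Qed.

Lemma HLnormZ (c : R[i]) a :
  HLnorm p (c *: a)%R = ((Normc.normc c)%:E * HLnorm p a)%E.
Proof.
rewrite /HLnorm (_ : (\sum_(_ <= _ <oo) _)%E =
  ((Normc.normc c `^ p)%:E * \sum_(0 <= n <oo) (term a n)%:E)%E); last first.
  rewrite -nneseriesZl ?lee_fin ?powR_ge0//; apply: eq_eseriesr => n _.
  by rewrite -EFinM /term mulrA -powRM// -Normc.normcM.
rewrite poweRM ?lee_fin ?powR_ge0//; last exact: nneseries_ge0.
by rewrite poweR_EFin -powRrM mulfV// powRr1.
Qed.

Lemma HLnorm0 : HLnorm p 0 = 0%E.
Proof.
rewrite /HLnorm eseries0 ?poweR0r ?invr_eq0// => n _ _.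
by rewrite Normc.normc0 powR0// mul0r.
Qed.

Lemma HLnorm_eq0 a : HLnorm p a = 0%E -> a = 0.
Proof.
move=> a0; apply/funext => n; apply: Normc.eq0_normc.
have {}a0 : (\sum_(0 <= k <oo) (term a k)%:E = 0)%E.
  by move: a0; apply: poweR_eq0_eq0; apply: nneseries_ge0 => k _ _; exact: term_ge0.
have: (term a n)%:E = 0%E.
  apply/eqP; rewrite eq_le term_ge0 andbT -a0 (nneseriesD1 (n := n))//.
  by rewrite leeDl// nneseries_ge0.
by move=> [/eqP]; rewrite mulf_eq0 !powR_eq0 pnatr_eq0 orbF => /andP[/eqP].
Qed.

Lemma HLpred_submod_closed : submod_closed (HLpred p).
Proof.
split=> [|c a b]; rewrite !unfold_in /HLpred ?HLnorm0// => fa fb.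
apply: le_lt_trans (ler_HLnormD _ _) _.
by rewrite HLnormZ lte_add_pinfty// lte_mul_pinfty// lee_fin.
Qed.

HB.instance Definition _ :=
  GRing.isSubmodClosed.Build _ _ (HLpred p) HLpred_submod_closed.
HB.instance Definition _ := [SubChoice_isSubLmodule of HL p1 by <:].

Let nm (a : HL p1) : R[i] := (fine (HLnorm p a))%:C%C.

Lemma HLnorm_fin_num (a : HL p1) : HLnorm p a \is a fin_num.
Proof. by rewrite ge0_fin_numE ?HLnorm_ge0//; exact: HLseqP. Qed.

Let ler_nmD (a b : HL p1) : nm (a + b) <= nm a + nm b.
Proof.
rewrite -rmorphD/= lecR -lee_fin EFinD !fineK ?HLnorm_fin_num//.
exact: ler_HLnormD.
Qed.

Let nmZ (c : R[i]) (a : HL p1) : nm (c *: a) = `|c| * nm a.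
Proof. by rewrite normc_def /nm HLnormZ fineM ?HLnorm_fin_num// rmorphM; case: c. Qed.

Let nm_eq0 (a : HL p1) : nm a = 0 -> a = 0.
Proof.
move=> [a0]; apply/val_inj/HLnorm_eq0.
by rewrite -(fineK (HLnorm_fin_num a)) a0.
Qed.

HB.instance Definition _ :=
  Lmodule_isNormed.Build R[i] (HL p1) ler_nmD nmZ nm_eq0.

Lemma HL_normE (a : HL p1) : `|a| = (fine (HLnorm p a))%:C%C.
Proof. by []. Qed.

End HL_normed_module.

Section operators.
Context (R : realType) (p : R) (p1 : 1 < p).

(* Operators into sequences are kept as functions [HL p1 -> nat -> R[i]^o], so
   that their norm makes sense, with value +oo, when they are not bounded. *)
Definition opnorm (A : HL p1 -> nat -> R[i]^o) : \bar R :=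
  ereal_sup [set HLnorm p (A a) | a in [set a : HL p1 | (HLnorm p a <= 1)%E]].

Definition compact_operator (T : {linear HL p1 -> HL p1}) : Prop :=
  compact (closure (T @` [set a : HL p1 | `|a| <= 1])).

Definition essnorm (A : HL p1 -> nat -> R[i]^o) : \bar R :=
  ereal_inf [set opnorm (fun a => A a - T a) |
    T in [set T : {linear HL p1 -> HL p1} | compact_operator T]].

Definition Hterm (g a : nat -> R[i]^o) (k n : nat) : R[i]^o :=
  g k * a n / (n.+1 + k.+1)%:R.

Definition Hop (g : nat -> R[i]^o) (a : HL p1) (k : nat) : R[i]^o :=
  limn (series (Hterm g a k)).

(* The first conjunct says that [Hop g] is well defined on the whole space: where
   the series diverges, [limn] is a junk value. *)
Definition Hop_bounded (g : nat -> R[i]^o) : Prop :=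
  (forall (a : HL p1) k, cvgn (series (Hterm g a k))) /\
  exists M : R, forall a : HL p1, (HLnorm p (Hop g a) <= M%:E * HLnorm p a)%E.

End operators.
Arguments Hop {R p} p1 g a k.

(* [G p d g n] is G(n+1; d; g). *)
Definition G (R : realType) (p : R) (d : nat -> nat) (g : nat -> R[i]^o)
    (n : nat) : R :=
  (\sum_(d n <= k < d n.+1) Normc.normc (g k.-1) `^ p)
    / ((d n.+1)%:R - (d n)%:R).

(* Main.v *)
Require Import Defs.
From HB Require Import structures.
From mathcomp Require Import all_boot all_order all_algebra.
From mathcomp Require Import complex.
From mathcomp Require Import all_classical all_reals all_analysis.
From mathcomp Require Import ring lra zify.

(** The constant comes from an exact identity that replaces the Beta integral.
  With [u_n = prod_(j < n) (j + b) / (j + 1)] and [v_n] the same product for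
  [1 - b], telescoping gives [sum_n u_n / (n + k) = 1 / (k v_k)], while
  [n u_n v_n] tends to [sin (pi b) / pi]; the latter is Euler's product for the
  sine, obtained from the recurrence for the integrals of
  [cos (2 b x) cos^(2n) x] over [0, pi/2].  Weights built from [u] and [v] in
  the Schur test then give Hilbert's inequality on [HL^p], asymptotically with
  the sharp constant [pi / sin (pi / p)].

  Truncations of [H_g] to finitely many output coordinates are compact, and the
  tails of a compact operator are small; so the essential norm of [H_g] is the
  infimum of the norms of the tails of [H_g].  For [a >= 0] the sequence [H a]
  varies slowly, so that on a block [[d_n, rd_n]] one may replace [|g_k|^p] by
  its average, up to a factor tending to 1 with [r].  This gives the dyadic
  criterion and (i), the lower bound being tested on truncations of
  [n^(-1 + 1/p)].  For (ii), put all the mass of [|g|^p] at the last point of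
  each block, or move a part [lam d_n] of it to the first point: the averages
  are the same, but the total mass near [d_n], and with it the [p]-th power of
  the essential norm, is multiplied asymptotically by [1 + lam]. *)


Import Order.TTheory GRing.Theory Num.Theory.
Import numFieldNormedType.Exports.

Set Implicit Arguments.
Unset Strict Implicit.
Unset Printing Implicit Defensive.

Local Open Scope classical_set_scope.
Local Open Scope ring_scope.

(** * Euler's product for the sine *)

(** Finitely many outputs do not affect the essential norm, but every input index has to be kept.
    Schur's test is therefore used asymmetrically: its condition on the inputs must hold for every
    [n] without loss, and the exact identity supplies it with constant 1; its condition on the
    outputs is needed only for [k >= N], where an asymptotic statement suffices, and the whole
    constant is collected there. Taken separately, the asymptotic constants of [u] and [v] are
    values of 1/Gamma; only their product enters, so the sine product stands in for the reflection
    formula. Block averages suffice because [h_k = sum_n x_n / (n + k)] decreases while [k h_k]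
    increases, for every [x >= 0]: the variation of [h] over a block is bounded by the ratio of its
    ends, uniformly in [x]. In (ii) the comparison of the two sequences is multiplicative, so it
    separates them only once one of the essential norms is known to be positive. *)

Section sine_product.
Context {R : realType}.
(* The antiderivatives of [cos (2 b x) cos^(2n) x], by recursion on [n] from one
   [A0] of [cos (2 b x)] (two integrations by parts); this avoids integrals. *)
Fixpoint cosint (A0 : R -> R) (b : R) (n : nat) : R -> R :=
  if n is m.+1 then fun x =>
    (n%:R ^+ 2 *+ 2 - b ^+ 2 *+ 2)^-1 *
    (n%:R * (n%:R *+ 2 - 1) * cosint A0 b m x
     + n%:R * (cos (2 * b * x) * (cos x ^+ m.*2.+1 * sin x))
     - b * (sin (2 * b * x) * cos x ^+ n.*2))
  else A0.

Lemma is_derive_cosint A0 (b x : R) n : 0 <= b < 1 ->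
  is_derive x 1 A0 (cos (2 * b * x)) ->
  is_derive x 1 (cosint A0 b n) (cos (2 * b * x) * cos x ^+ n.*2).
Proof.
move=> b01 dA0; elim: n => [|n IH].
  by rewrite expr0 mulr1.
have nb : (n.+1%:R ^+ 2 *+ 2 - b ^+ 2 *+ 2 : R) != 0.
  have [b0 b1] := andP b01.
  have n1 : 1 <= n.+1%:R :> R by rewrite ler1n.
  rewrite gt_eqF//; nra.
rewrite /=.
have dl : is_derive x 1 ( *%R (2 * b)) (2 * b).
  have := is_deriveZ (2 * b) (is_derive_id x (1:R)).
  by rewrite /GRing.scale /= mulr1.
have dC : is_derive x 1 (fun y => cos (2 * b * y)) (- sin (2 * b * x) * (2 * b)).
  exact: (@is_derive1_comp _ _ ( *%R (2 * b))).
have dS : is_derive x 1 (fun y => sin (2 * b * y)) (cos (2 * b * x) * (2 * b)).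
  exact: (@is_derive1_comp _ _ ( *%R (2 * b))).
have dX k : is_derive x 1 (fun y => cos y ^+ k) (k%:R * cos x ^+ k.-1 * - sin x).
  have -> : (fun y => cos y ^+ k) = (@cos R) ^+ k by apply/funext => y; rewrite fctE.
  exact: is_deriveX.
have dA := is_deriveZ _ (is_deriveB (is_deriveD (is_deriveZ (n.+1%:R * (n.+1%:R *+ 2 - 1)) IH)
  (is_deriveZ n.+1%:R (is_deriveM dC (is_deriveM (dX n.*2.+1) (is_derive_sin x)))))
  (is_deriveZ b (is_deriveM dS (dX n.+1.*2)))).
apply: (is_derive_eq (dA _)) => {dA}.
rewrite /GRing.scale /= {dX dC dS dl dA0 IH b01}.
rewrite mulrfctE doubleS !(exprSr _ n.*2.+1) !(exprSr _ n.*2).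
have -> : n.*2.+2%:R = 2 * n.+1%:R :> R by rewrite -doubleS -mul2n natrM.
have -> : n.*2.+1%:R = 2 * n.+1%:R - 1 :> R.
  by rewrite -mul2n -!natr1 natrM; ring.
have s2 := sin2cos2 x; move: nb s2.
move: (cos (2 * b * x)) (sin (2 * b * x)) (cos x ^+ n.*2) (sin x) (cos x) (n.+1%:R : R) => C S Q s c N.
move=> nb s2.
rewrite -[RHS](mulKf nb); congr (_ * _).
by ring: s2.
Qed.

Lemma cosint_at0 A0 (b : R) n : A0 0 = 0 -> cosint A0 b n 0 = 0.
Proof. by move=> A00; elim: n => //= n ->; rewrite !mulr0 sin0 !mul0r !mulr0 addr0 subr0 mulr0. Qed.

Lemma cosint_pihalf A0 (b : R) n :
  cosint A0 b n.+1 (pi / 2) =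
  n.+1%:R * (n.+1%:R *+ 2 - 1) / (n.+1%:R ^+ 2 *+ 2 - b ^+ 2 *+ 2) * cosint A0 b n (pi / 2).
Proof.
rewrite /= cos_pihalf doubleS !expr0n /= !mul0r !mulr0 addr0 subr0.
by rewrite mulrA [X in X * _]mulrC.
Qed.

(** Plays the part of monotonicity of the integral: definite integrals are compared through their
    antiderivatives. *)
Lemma le_of_derive_ge0 (f df : R -> R) (a b : R) : a <= b ->
  (forall x : R, is_derive x 1 f (df x)) -> (forall x, a <= x <= b -> 0 <= df x) ->
  f a <= f b.
Proof.
move=> ab fd df0.
have fE x : derive1 f x = df x by rewrite derive1E derive_val.
apply: (@ger0_derive1_le_cc _ f a b); rewrite ?in_itv/= ?lexx ?ab//.
- by move=> x; rewrite in_itv/= fE => /andP[/ltW ax /ltW xb]; apply: df0; rewrite ax.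
- apply: continuous_subspaceT => x; apply/differentiable_continuous/derivable1_diffP.
  by have [] := fd x.
Qed.

(** The integrals over [0, pi/2] of [cos^(2n) x] and, for [cosintb], of [cos (2 b x) cos^(2n) x],
    since the antiderivatives vanish at 0. The case [b = 0] is kept apart because of the division by
    [2 b]. *)
Definition cosint0 n : R := cosint id 0 n (pi / 2).
Definition cosintb (b : R) n : R := cosint (fun x => (2 * b)^-1 * sin (2 * b * x)) b n (pi / 2).

Lemma cosint0S n : cosint0 n.+1 = (1 - (2 * n.+1%:R)^-1) * cosint0 n.
Proof.
rewrite /cosint0 cosint_pihalf (expr0n _ 2)/= mul0rn subr0; congr (_ * _).
have : n.+1%:R != 0 :> R by rewrite pnatr_eq0.
by move: n.+1%:R => N N0; field.
Qed.

Lemma cosint0_gt0 n : 0 < cosint0 n.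
Proof.
elim: n => [|n IH]; first by rewrite /cosint0 /= divr_gt0 ?pi_gt0.
rewrite cosint0S mulr_gt0// subr_gt0 invf_lt1 ?mulr_gt0//.
by rewrite -natrM ltr1n mul2n doubleS.
Qed.

Let id0 (x : R) : is_derive x 1 (id : R -> R) (cos (2 * 0 * x)).
Proof. by rewrite mulr0 mul0r cos0; exact: is_derive_id. Qed.

Let idb (b x : R) : 0 < b ->
  is_derive x 1 (fun x => (2 * b)^-1 * sin (2 * b * x)) (cos (2 * b * x)).
Proof.
move=> b0.
have dl : is_derive x 1 ( *%R (2 * b)) (2 * b).
  have := is_deriveZ (2 * b) (is_derive_id x (1:R)).
  by rewrite /GRing.scale /= mulr1.
have dS : is_derive x 1 (fun y => sin (2 * b * y)) (cos (2 * b * x) * (2 * b)).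
  exact: (@is_derive1_comp _ _ ( *%R (2 * b))).
apply: (is_derive_eq (is_deriveZ (2 * b)^-1 dS)).
by rewrite /GRing.scale /=; field; rewrite gt_eqF.
Qed.

(** On [0, pi/2], [0 <= 1 - cos (2 b x) = 2 sin^2 (b x) <= 2 sin^2 x], and the integral of
    [2 sin^2 x cos^(2n) x] is [2 (cosint0 n - cosint0 n.+1) = cosint0 n / (n + 1)]. *)
Lemma cosintb_bounds (b : R) n : 0 < b < 1 ->
  (1 - n.+1%:R^-1) * cosint0 n <= cosintb b n <= cosint0 n.
Proof.
move=> /andP[b0 b1].
have b01 : 0 <= b < 1 by rewrite ltW.
have z01 : 0 <= (0 : R) < 1 by rewrite lexx ltr01.
have d0 m x := is_derive_cosint m z01 (id0 x).
have db x := is_derive_cosint n b01 (idb x b0).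
have pi20 : 0 <= pi / 2 :> R by rewrite divr_ge0 ?pi_ge0.
have cosE x : cos (2 * b * x) = 1 - sin (b * x) ^+ 2 *+ 2.
  rewrite -mulrA mulr_natl cos_mulr2n -/((b * x)) cos2sin2; ring.
have cos1 (x : R) : cos (2 * 0 * x) = 1 by rewrite mulr0 mul0r cos0.
have z0 m : cosint id 0 m 0 = 0 :> R by rewrite cosint_at0.
have zb : cosint (fun x => (2 * b)^-1 * sin (2 * b * x)) b n 0 = 0.
  by rewrite cosint_at0// mulr0 sin0 mulr0.
apply/andP; split; last first.
  have := le_of_derive_ge0 pi20 (fun x => is_deriveB (d0 n x) (db x)).
  rewrite !fctE z0 zb subrr subr_ge0; apply.
  move=> x _; rewrite cos1 cosE -mulrBl mulr_ge0//; last by rewrite exprn_even_ge0 ?odd_double.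
  by rewrite subKr mulrn_wge0// sqr_ge0.
pose D := cosint (fun x => (2 * b)^-1 * sin (2 * b * x)) b n.
(* An antiderivative of [(2 sin^2 x - (1 - cos (2 b x))) cos^(2n) x] that vanishes at 0. *)
pose h x := 2 *: (cosint id 0 n x - cosint id 0 n.+1 x) - (cosint id 0 n x - D x).
have H := @le_of_derive_ge0 h _ 0 (pi / 2) pi20 (fun x => is_deriveB
  (is_deriveZ 2 (is_deriveB (d0 n x) (d0 n.+1 x))) (is_deriveB (d0 n x) (db x))).
rewrite /h !z0 /D zb !subrr scaler0 subrr in H.
rewrite -/(cosint0 n) -/(cosint0 n.+1) -/(cosintb b n) in H.
have {H} : 0 <= 2 *: (cosint0 n - cosint0 n.+1) - (cosint0 n - cosintb b n).
  apply: H => x /andP[x0 xpi]; rewrite /GRing.scale /= !cos1 cosE doubleS !(exprS _ n.*2.+1) !(exprS _ n.*2).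
  have s0 : 0 <= sin (b * x).
    by apply: sin_ge0_pi; rewrite mulr_ge0 ?(ltW b0)//=; have := pi_ge0 R; nra.
  have s1 : sin (b * x) <= sin x.
    by rewrite leNgt ltr_sin ?in_itv/= -?leNgt; nra.
  have s2 := sin2cos2 x.
  have : 0 <= cos x ^+ n.*2 by rewrite exprn_even_ge0 ?odd_double.
  have : 0 <= sin x ^+ 2 - sin (b * x) ^+ 2 by rewrite subr_ge0 lerXn2r ?nnegrE// (le_trans s0).
  rewrite s2; move: (cos x ^+ n.*2) => Q; move: (sin (b * x)) (cos x) => S c h1 h2.
  rewrite [leRHS](_ : _ = 2 * ((1 - c ^+ 2 - S ^+ 2) * Q)); last by ring.
  by rewrite mulr_ge0// mulr_ge0.
rewrite cosint0S /GRing.scale /= -mulr_natl => H.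
rewrite -subr_ge0; apply: le_trans H _; rewrite le_eqVlt; apply/orP; left; apply/eqP.
have : n.+1%:R != 0 :> R by rewrite pnatr_eq0.
by move: n.+1%:R => N N0; field.
Qed.
End sine_product.

(** * Asymptotics of the rising products *)

Section rising.
Context {R : realType}.
Implicit Types b s x : R.

(** The coefficient of [z^n] in [(1 - z)^(-b)]. *)
Definition rising b n : R := \prod_(j < n) ((j%:R + b) / j.+1%:R).

Lemma rising0 b : rising b 0 = 1.
Proof. by rewrite /rising big_ord0. Qed.

Lemma risingS b n : rising b n.+1 = rising b n * ((n%:R + b) / n.+1%:R).
Proof. by rewrite /rising big_ord_recr. Qed.

Lemma rising_gt0 b n : 0 < b -> 0 < rising b n.
Proof. by move=> b0; rewrite prodr_gt0// => i _; rewrite divr_gt0// ltr_wpDl. Qed.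

(** Both sides obey the same recurrence in [n]: the factor [N + b] of the first product cancels
    against the denominator [N^2 - b^2] in the recurrence of the cosine integrals. The sine comes
    from [n = 0], where the integral is [sin (pi b) / (2 b)]. *)
Lemma rising_sine b n : 0 < b < 1 ->
  n.+1%:R * rising b n.+1 * rising (1 - b) n.+1 * cosintb b n =
  (1 - b / n.+1%:R) * cosint0 n * (sin (pi * b) / pi).
Proof.
move=> /andP[b0 b1]; elim: n => [|n IH].
  rewrite !risingS !rising0 /cosint0 /cosintb /= !add0r !divr1 !mul1r.
  have -> : 2 * b * (pi / 2) = pi * b :> R by field.
  have : (pi : R) != 0 by rewrite gt_eqF ?pi_gt0.
  by move: (pi : R) (sin _) => P S P0; field; rewrite P0 gt_eqF.
rewrite !(risingS _ n.+1) cosint0S /cosintb cosint_pihalf -/(cosintb b n).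
have n1 : 1 <= n.+1%:R :> R by rewrite ler1n.
move: IH n1; rewrite -(natr1 n.+1); move: (n.+1%:R) => N.
move: (rising b n.+1) (rising (1 - b) n.+1) (cosintb b n) (cosint0 n) (sin (pi * b) / pi) => u v C C0 K IH N1.
have Nn0 : N != 0 by rewrite gt_eqF//; lra.
have N1n0 : N + 1 != 0 by rewrite gt_eqF//; lra.
have Nbn0 : N ^+ 2 * 2 - b ^+ 2 * 2 != 0 by rewrite gt_eqF//; nra.
have -> : (N + 1) * (u * ((N + b) / (N + 1))) * (v * ((N + (1 - b)) / (N + 1))) *
   (N * (N *+ 2 - 1) / (N ^+ 2 *+ 2 - b ^+ 2 *+ 2) * C) =
  (N * u * v * C) * ((N + b) * (N + 1 - b) * (N *+ 2 - 1) / (N ^+ 2 *+ 2 - b ^+ 2 *+ 2) / (N + 1)).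
  by field; rewrite ?N1n0 ?Nbn0.
by rewrite IH; field; rewrite ?Nn0 ?Nbn0 ?N1n0.
Qed.

(** Concavity of [x^s], as Young's inequality for [x^s] and 1 with exponents [1/s] and
    [1/(1 - s)]. *)
Lemma powR_le_affine s x : 0 < s < 1 -> 0 <= x -> x `^ s <= 1 + s * (x - 1).
Proof.
move=> /andP[s0 s1] x0.
have := @conjugate_powR R (x `^ s) 1 s^-1 (1 - s)^-1 (powR_ge0 _ _) ler01.
rewrite !invr_gt0 subr_gt0 s0 s1 !invrK subrKC => /(_ isT isT erefl).
rewrite -powRrM divff ?gt_eqF// powRr1// powR1 mulr1.
by move=> /le_trans; apply; rewrite le_eqVlt; apply/orP; left; apply/eqP; ring.
Qed.

Lemma cvg_powRN0 s : 0 < s -> n.+1%:R `^ (- s) @[n --> \oo] --> (0 : R).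
Proof.
move=> s0; have -> : (fun n => n.+1%:R `^ (- s) : R) = (@powR R ^~ s) \o harmonic.
  by apply/funext => n; rewrite /= powRN -powR_inv1// -powRrM mulrC powRrM powR_inv1// powR_ge0.
apply: cvg_comp (powR_cvg0 s0).
have h : (@harmonic R) @ \oo --> 0^'+.
  move=> A hA; have /= hn : \forall n \near \oo, 0 < harmonic n :> R -> A (harmonic n).
    exact: (@cvg_harmonic R _ hA).
  by apply: filterS hn => n; apply; exact: harmonic_gt0.
exact: h.
Qed.

(** The left side starts at 1 and does not increase: with [t = (1 - b) / (n + 1)], one step
    multiplies it by at most [(1 + t) (1 - t)]. *)
Lemma rising_scaled_le1 b n : 0 < b < 1 -> n.+1%:R `^ (1 - b) * rising b n <= 1.
Proof.
move=> /andP[b0 b1]; elim: n => [|n]; first by rewrite rising0 powR1 mulr1.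
move=> IH; apply: le_trans IH; rewrite risingS.
have N0 : 0 < n.+1%:R :> R by rewrite ltr0n.
have -> : n.+2%:R = n.+1%:R * (1 + n.+1%:R^-1) :> R.
  by rewrite mulrDr mulr1 divff ?gt_eqF// natr1.
rewrite powRM ?addr_ge0 ?invr_ge0 ?(ltW N0)// -mulrA ler_wpM2l ?powR_ge0//.
have u0 := ltW (rising_gt0 n b0).
rewrite mulrCA ler_piMr//.
have : (1 + n.+1%:R^-1) `^ (1 - b) <= 1 + (1 - b) * n.+1%:R^-1.
  apply: le_trans (powR_le_affine _ _) _; rewrite ?addr_ge0 ?invr_ge0 ?(ltW N0)//.
    by rewrite subr_gt0 b1 gtrBl.
  by rewrite (addrC 1 n.+1%:R^-1) addrK.
have -> : (n%:R + b) / n.+1%:R = 1 - (1 - b) * n.+1%:R^-1.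
  have := gt_eqF N0; rewrite -natr1; move: n%:R => N /negbT N1; field; exact: N1.
move: (_ `^ _) => Z.
have : 0 < (n.+1%:R^-1 : R) <= 1 by rewrite invr_gt0 N0 invf_le1// ler1n.
move: n.+1%:R^-1 => h /andP[h0 h1] Zh.
have : 0 <= 1 - (1 - b) * h by nra.
by move: ((1 - b) * h) Zh => t Zt t1; nra.
Qed.

Lemma rising_scaled_nd b : 0 < b < 1 ->
  nondecreasing_seq (fun n => n.+1%:R `^ (1 - b) * rising b n.+1).
Proof.
move=> b01; have /andP[b0 b1] := b01; apply/nondecreasing_seqP => n.
rewrite (risingS _ n.+1) mulrA mulrAC ler_wpM2r ?(ltW (rising_gt0 _ b0))//.
have N0 : 0 < n.+1%:R :> R by rewrite ltr0n.
have M0 : 0 < n.+2%:R :> R by rewrite ltr0n.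
have {1}-> : n.+1%:R = n.+2%:R * (n.+1%:R / n.+2%:R) :> R by rewrite mulrC divfK ?gt_eqF.
rewrite powRM ?divr_ge0 ?(ltW N0) ?(ltW M0)// ler_wpM2l ?powR_ge0//.
apply: le_trans (powR_le_affine _ _) _; rewrite ?divr_ge0 ?(ltW N0) ?(ltW M0)//.
  by rewrite subr_gt0 b1 gtrBl.
rewrite le_eqVlt; apply/orP; left; apply/eqP.
have := gt_eqF M0; rewrite -(natr1 n.+1); move: n.+1%:R => N /negbT N1; field; exact: N1.
Qed.

Lemma rising_asymp b : 0 < b < 1 -> exists2 g : R, 0 < g &
  n.+1%:R `^ (1 - b) * rising b n.+1 @[n --> \oo] --> g.
Proof.
move=> b01; have /andP[b0 b1] := b01.
have cv : cvgn (fun n => n.+1%:R `^ (1 - b) * rising b n.+1).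
  apply: nondecreasing_is_cvgn; first exact: rising_scaled_nd.
  exists 1 => _ [n _ <-]; apply: le_trans (rising_scaled_le1 n.+1 b01).
  rewrite ler_wpM2r ?(ltW (rising_gt0 _ b0))//.
  by rewrite ge0_ler_powR ?subr_ge0 ?(ltW b1) ?nnegrE// ler_nat.
exists (limn (fun n => n.+1%:R `^ (1 - b) * rising b n.+1)) => //.
apply: (@lt_le_trans _ _ b) => //.
have := nondecreasing_cvgn_le (rising_scaled_nd b01) cv 0.
by rewrite powR1 mul1r risingS rising0 mul1r add0r divr1.
Qed.

Lemma rising_product_cvg b : 0 < b < 1 ->
  n.+1%:R * rising b n.+1 * rising (1 - b) n.+1 @[n --> \oo] --> sin (pi * b) / pi.
Proof.
move=> b01; have /andP[b0 b1] := b01.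
have C0 := @cosint0_gt0 R.
have h0 : n.+1%:R^-1 @[n --> \oo] --> (0 : R) by exact: cvg_harmonic.
have r1 : cosintb b n / cosint0 n @[n --> \oo] --> (1 : R).
  apply: (@squeeze_cvgr _ _ _ _ (fun n => 1 - n.+1%:R^-1) (fun=> 1)).
  - near=> n; have /andP[l u] := cosintb_bounds n b01.
    by rewrite ler_pdivrMr// ler_pdivlMr// l mul1r.
  - by rewrite -[X in _ --> X]subr0; apply: cvgB => //; exact: cvg_cst.
  - exact: cvg_cst.
(* At [n = 0] the lower bound in [cosintb_bounds] is 0, whereas the integral has to be positive to
   be divided out. *)
have E n : (0 < n)%N -> n.+1%:R * rising b n.+1 * rising (1 - b) n.+1 =
    (1 - b * n.+1%:R^-1) * (sin (pi * b) / pi) * (cosintb b n / cosint0 n)^-1.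
  move=> n0; have Cb : 0 < cosintb b n.
    have /andP[+ _] := cosintb_bounds n b01; apply: lt_le_trans.
    by rewrite mulr_gt0// subr_gt0 invf_lt1// ltr1n.
  apply: (mulIf (lt0r_neq0 Cb)); rewrite rising_sine// invf_div.
  by rewrite (mulrA _ (cosint0 n)) (divfK (lt0r_neq0 Cb)) mulrAC.
apply: (@cvg_trans _ ((1 - b * n.+1%:R^-1) * (sin (pi * b) / pi) * (cosintb b n / cosint0 n)^-1 @[n --> \oo])).
  by apply: near_eq_cvg; near=> n; rewrite E//; near: n; exact: nbhs_infty_gt.
suff : (1 - b * n.+1%:R^-1) * (sin (pi * b) / pi) * (cosintb b n / cosint0 n)^-1 @[n --> \oo]
    --> (1 - b * 0) * (sin (pi * b) / pi) * 1^-1.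
  by rewrite mulr0 subr0 mul1r invr1 mulr1.
apply: cvgM; last exact: (cvgV (oner_neq0 _) r1).
apply: cvgMr_tmp; apply: cvgB; first exact: cvg_cst.
exact: cvgMl_tmp.
Unshelve. all: by end_near. Qed.
End rising.

(** * Sums against the Hilbert kernel *)

Section hilbert_sums.
Context {R : realType}.
Implicit Types (a x y : nat -> R) (b : R).

Lemma cvgn_eq (f g : nat -> R) (l : R) : f =1 g -> f n @[n --> \oo] --> l ->
  g n @[n --> \oo] --> l.
Proof. by move=> /funext ->. Qed.

Definition hterm a (k n : nat) : R := a n / (n.+1 + k.+1)%:R.

Definition hsum a (k : nat) : R := limn (series (hterm a k)).

Lemma rising_cvg0 b : 0 < b < 1 -> rising b n @[n --> \oo] --> 0.
Proof.
move=> b01; have /andP[b0 b1] := b01.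
apply: (@squeeze_cvgr _ _ _ _ (fun=> 0) (fun n => n.+1%:R `^ (- (1 - b)))).
- near=> n; rewrite ltW ?rising_gt0//= powRN -div1r ler_pdivlMr ?powR_gt0 ?ltr0n//.
  by rewrite mulrC rising_scaled_le1.
- exact: cvg_cst.
- by apply: cvg_powRN0; rewrite subr_gt0.
Unshelve. all: by end_near. Qed.

(* The recurrence in [k] comes from telescoping
   [t_n = rising b n * n / (n + k)]. *)
Lemma rising_series_cvg b k : 0 < b < 1 ->
  series (fun n => rising b n / (n + k.+1)%:R) @ \oo -->
  (k.+1%:R * rising (1 - b) k.+1)^-1.
Proof.
move=> b01; have /andP[b0 b1] := b01; have u0 := rising_cvg0 b01.
have b1n : 1 - b != 0 by rewrite gt_eqF// subr_gt0.
elim: k => [|k IH].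
  have -> : series (fun n => rising b n / (n + 1)%:R) = (fun n => (1 - rising b n) * (1 - b)^-1).
    apply/funext; elim=> [|n IH]; first by rewrite /series/= big_geq// rising0 subrr mul0r.
    rewrite seriesSr IH risingS addn1 /=.
    have : n.+1%:R != 0 :> R by rewrite pnatr_eq0.
    by rewrite -natr1; move: (n%:R) (rising b n) => N u N0; field; rewrite ?N0 ?b1n.
  rewrite risingS rising0 !mul1r add0r divr1.
  suff : (1 - rising b n) * (1 - b)^-1 @[n --> \oo] --> (1 - 0) * (1 - b)^-1.
    by rewrite subr0 mul1r.
  by apply: cvgMr_tmp; apply: cvgB => //; exact: cvg_cst.
have kb : (k.+1%:R + (1 - b) : R) != 0 by rewrite gt_eqF// addr_gt0 ?ltr0n// subr_gt0.
have -> : series (fun n => rising b n / (n + k.+2)%:R) =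
    (fun n => (k.+1%:R * series (fun n => rising b n / (n + k.+1)%:R) n -
       rising b n * (n%:R / (n + k.+1)%:R)) * (k.+1%:R + (1 - b))^-1).
  apply/funext; elim=> [|n IHn].
    by rewrite /series/= !big_geq// !mul0r !mulr0 subrr mul0r.
  rewrite !seriesSr IHn risingS /=.
  have : (n + k.+1)%:R != 0 :> R by rewrite pnatr_eq0 addnS.
  have : (n + k.+2)%:R != 0 :> R by rewrite pnatr_eq0 addnS.
  have : n.+1%:R != 0 :> R by rewrite pnatr_eq0.
  have -> : (n.+1 + k.+1)%N = (n + k.+2)%N by lia.
  rewrite !natrD -!natr1.
  move: (series _ _) (rising b n) kb; rewrite -natr1.
  move: (n%:R) (k%:R) => N K S u h1 h2 h3 h4.
  by field; rewrite ?h2 ?h1 ?h3 ?h4.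
have v0 : rising (1 - b) k.+1 != 0 by rewrite gt_eqF// rising_gt0// subr_gt0.
have -> : (k.+2%:R * rising (1 - b) k.+2)^-1 =
    (k.+1%:R * (k.+1%:R * rising (1 - b) k.+1)^-1 - 0) * (k.+1%:R + (1 - b))^-1.
  rewrite (risingS _ k.+1).
  have : k.+1%:R != 0 :> R by rewrite pnatr_eq0.
  have : k.+2%:R != 0 :> R by rewrite pnatr_eq0.
  move: (rising _ _) v0 kb; rewrite -(natr1 k.+1); move: (k.+1%:R) => K v v0 kb K1 K0.
  by field; rewrite ?v0 ?kb ?K0 ?K1.
apply: cvgMr_tmp; apply: cvgB; first exact: cvgMl_tmp.
apply: (@squeeze_cvgr _ _ _ _ (fun=> 0) (rising b)) => //; last exact: cvg_cst.
near=> n; have un := ltW (rising_gt0 n b0).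
rewrite mulr_ge0//= ler_piMr// ler_pdivrMr ?ltr0n ?addnS// mul1r ler_nat.
by rewrite -addnS leq_addr.
Unshelve. all: by end_near. Qed.

Lemma hterm_ge0 a k n : (forall n, 0 <= a n) -> 0 <= hterm a k n.
Proof. by move=> a0; rewrite divr_ge0. Qed.

(** The sum starts one index later than in [rising_series_cvg]; the subtracted [1 / k.+1] is the
    missing term [rising b 0 / k.+1]. Its sign is the favourable one in Schur's test. *)
Lemma hsum_rising b k : 0 < b < 1 ->
  series (hterm (fun n => rising b n.+1) k) @ \oo -->
    (k.+1%:R * rising (1 - b) k.+1)^-1 - k.+1%:R^-1.
Proof.
move=> b01; have := @rising_series_cvg b k b01; rewrite -cvg_shiftS => h.
have -> : series (hterm (fun n => rising b n.+1) k) =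
    (fun n => series (fun n => rising b n / (n + k.+1)%:R) n.+1 - k.+1%:R^-1).
  apply/funext; elim=> [|n IH].
    by rewrite seriesSr /series/= !big_geq// add0r rising0 div1r subrr.
  by rewrite seriesSr IH [in RHS]seriesSr addrAC.
by apply: cvgB => //; exact: cvg_cst.
Qed.

Lemma is_cvg_hterm_le x y c k : (forall n, 0 <= x n) ->
  (forall n, x n <= c * y n) -> cvgn (series (hterm y k)) -> cvgn (series (hterm x k)).
Proof.
move=> x0 xy cy.
apply: (@series_le_cvg _ _ (c *: hterm y k)); last exact: is_cvg_seriesZ.
- by move=> n; rewrite hterm_ge0.
- move=> n; rewrite -[leRHS]/(c * (y n / _)) mulrA divr_ge0// (le_trans (x0 n))//.
- by move=> n; rewrite -[leRHS]/(c * (y n / _)) mulrA ler_wpM2r.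
Qed.

(** Beyond [M] the relative error [e] passes to the sum; the earlier terms are estimated with
    [1 / (n + k) <= 1 / k]. *)
Lemma hsum_sub_le x y c e M k : 0 <= e -> (forall n, 0 <= y n) ->
  (forall n, (M <= n)%N -> `|x n - c * y n| <= e * y n) ->
  cvgn (series (hterm x k)) -> cvgn (series (hterm y k)) ->
  `|hsum x k - c * hsum y k| <= e * hsum y k + (\sum_(0 <= j < M) `|x j - c * y j|) / k.+1%:R.
Proof.
move=> e0 y0 xy cx cy.
have cz : (series (hterm x k) n - c * series (hterm y k) n) @[n --> \oo] --> hsum x k - c * hsum y k.
  by apply: cvgB => //; apply: cvgMl_tmp.
apply: (@ler_cvg_to _ _ _ _ _ (fun=> e * hsum y k + (\sum_(0 <= j < M) `|x j - c * y j|) / k.+1%:R) _ _ (cvg_norm cz) (cvg_cst _)).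
near=> n.
have -> : series (hterm x k) n - c * series (hterm y k) n =
    \sum_(0 <= j < n) (x j - c * y j) / (j.+1 + k.+1)%:R.
  rewrite /series/= mulr_sumr -sumrB; apply: eq_bigr => j _.
  by rewrite mulrBl mulrA.
apply: le_trans (ler_norm_sum _ _ _) _.
pose D j := if (j < M)%N then `|x j - c * y j| else 0.
have D0 j : 0 <= D j by rewrite /D; case: ifP.
apply: (@le_trans _ _ (\sum_(0 <= j < n) (e * hterm y k j + D j / k.+1%:R))).
  apply: ler_sum => j _; rewrite normrM normfV (ger0_norm (ler0n _ _)).
  apply: (@le_trans _ _ (e * hterm y k j + D j / (j.+1 + k.+1)%:R)).
    rewrite /hterm mulrA -mulrDl ler_wpM2r// /D; case: ltnP => [_|Mj].
      by rewrite lerDr mulr_ge0.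
    by rewrite addr0 xy.
  rewrite lerD2l ler_wpM2l// lef_pV2 ?posrE ?ltr0n// ler_nat; exact: leq_addl.
rewrite big_split/= -mulr_sumr -mulr_suml lerD//.
  rewrite ler_wpM2l//; apply: (nondecreasing_cvgn_le _ cy).
  by apply: nondecreasing_series => ? _ _; exact: hterm_ge0.
rewrite ler_wpM2r//.
have -> : \sum_(0 <= j < M) `|x j - c * y j| = \sum_(0 <= j < M) D j.
  by rewrite !big_mkord; apply: eq_bigr => j _; rewrite /D ltn_ord.
have [nM|Mn] := leqP n M.
  by rewrite [leRHS](big_cat_nat _ nM)//= lerDl sumr_ge0.
rewrite (big_cat_nat _ (ltnW Mn))//= gerDl big_nat_cond big1// => j /andP[/andP[Mj _] _].
by rewrite /D ltnNge Mj.
Unshelve. all: by end_near. Qed.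

(** Only the ratio of the terms for large [n] matters: a finite head contributes [O(1/k)], which the
    last hypothesis makes negligible on the scale [w]. *)
Lemma hsum_equiv x y (c l : R) (w : nat -> R) : (forall n, 0 <= x n) -> (forall n, 0 < y n) ->
  x n / y n @[n --> \oo] --> c -> (forall k, cvgn (series (hterm y k))) ->
  (forall k, 0 <= w k) -> w k * hsum y k @[k --> \oo] --> l ->
  w k / k.+1%:R @[k --> \oo] --> 0 ->
  (forall k, cvgn (series (hterm x k))) /\ w k * hsum x k @[k --> \oo] --> c * l.
Proof.
move=> x0 y0 xyc cy w0 wl w1.
have cx k : cvgn (series (hterm x k)).
  have /cvg_seq_bounded/bounded_fun_has_ubound[C hC] : cvgn (fun n => x n / y n).
    by apply/cvg_ex; exists c.
  apply: (@is_cvg_hterm_le x y C) => // n; rewrite -ler_pdivrMr//.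
  by apply: hC; exists n.
split=> //.
have d0 : w k * (hsum x k - c * hsum y k) @[k --> \oo] --> 0.
  apply/cvgrPdist_le => e e0.
  pose e' := e / (`|l| + 1) / 2.
  have l1 : 0 < `|l| + 1 by rewrite ltr_wpDl.
  have e'0 : 0 < e' by rewrite !divr_gt0.
  have /cvgrPdist_le/(_ _ e'0)[M _ hM] := xyc.
  pose B := \sum_(0 <= j < M) `|x j - c * y j|.
  have hxy n : (M <= n)%N -> `|x n - c * y n| <= e' * y n.
    move=> /hM /=; rewrite distrC => xyn.
    have -> : x n - c * y n = (x n / y n - c) * y n by rewrite mulrBl divfK ?gt_eqF.
    by rewrite normrM (gtr0_norm (y0 n)) ler_wpM2r// ltW.
  have wl1 : \forall k \near \oo, w k * hsum y k <= `|l| + 1.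
    have /cvgrPdist_le/(_ _ ltr01) := wl; apply: filterS => k; rewrite ler_distlC => /andP[_].
    by move=> /le_trans; apply; rewrite lerD2r ler_norm.
  have wB : \forall k \near \oo, w k / k.+1%:R * B <= e / 2.
    have /cvgrPdist_le/(_ (e / 2)) : w k / k.+1%:R * B @[k --> \oo] --> 0 * B by exact: cvgMr_tmp.
    rewrite mul0r divr_gt0// => /(_ isT); apply: filterS => k.
    by rewrite sub0r normrN => /(le_trans (ler_norm _)).
  near=> k.
  rewrite sub0r normrN normrM (ger0_norm (w0 k)).
  apply: le_trans (_ : w k * (e' * hsum y k + B / k.+1%:R) <= _).
    by rewrite ler_wpM2l//; apply: hsum_sub_le => //; [exact: ltW|move=> n; exact: ltW].
  have h1 : w k * hsum y k <= `|l| + 1 by near: k.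
  have h2 : w k / k.+1%:R * B <= e / 2 by near: k.
  rewrite mulrDr mulrCA (mulrCA (w k) B) (mulrC B).
  apply: le_trans (lerD (ler_wpM2l (ltW e'0) h1) h2) _.
  by rewrite /e' mulrAC divfK ?gt_eqF// -splitr.
rewrite -[c * l]add0r; apply: (cvgn_eq _ (cvgD d0 (cvgMl_tmp wl))) => k /=.
by rewrite mulrCA -mulrDr subrK.
Unshelve. all: by end_near. Qed.

(** The discrete form of the integral of [t^(-al) / (1 + t)] over the half-line. The comparison
    sequence is [rising (1 - al)], whose sums are known exactly; the constants of the two rising
    products combine to [g g' = sin (pi al) / pi]. *)
Lemma hsum_asymp x (al tau : R) : 0 < al < 1 -> (forall n, 0 <= x n) ->
  n.+1%:R `^ al * x n @[n --> \oo] --> tau ->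
  (forall k, cvgn (series (hterm x k))) /\
  k.+1%:R `^ al * hsum x k @[k --> \oo] --> tau * (pi / sin (pi * al)).
Proof.
move=> al01 x0 xtau; have /andP[al0 al1] := al01.
pose b := 1 - al.
have b01 : 0 < b < 1 by rewrite subr_gt0 al1 gtrBl.
have alE : 1 - b = al by rewrite /b subKr.
have [g g0 hg] := rising_asymp b01; rewrite alE in hg.
have [g' g'0 hg'] := rising_asymp al01; rewrite -/b in hg'.
have k0 k : (k.+1%:R : R) != 0 by rewrite pnatr_eq0.
have kp k (s : R) : (k.+1%:R : R) `^ s != 0 by rewrite gt_eqF// powR_gt0 ?ltr0n.
have ggE : g * g' = sin (pi * al) / pi.
  apply: (cvg_unique _ (cvgM hg hg')) => //.
  have := rising_product_cvg al01; rewrite -/b; apply: cvg_trans; apply: near_eq_cvg.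
  near=> n; rewrite /= mulrACA -powRD ?k0 ?implybT// subrKC powRr1//.
  by rewrite -mulrA (mulrC (rising b _)).
pose y n := rising b n.+1.
have y0 n : 0 < y n by rewrite rising_gt0//; case/andP: b01.
have cy k := @hsum_rising b k b01.
have cy' k : cvgn (series (hterm y k)) by apply/cvg_ex; eexists; exact: cy.
have xy : x n / y n @[n --> \oo] --> tau / g.
  apply: (cvgn_eq _ (cvgM xtau (cvgV (lt0r_neq0 g0) hg))) => n /=.
  by rewrite invfM mulrACA divff ?mul1r.
have w1 : k.+1%:R `^ al / k.+1%:R @[k --> \oo] --> (0 : R).
  have b0 : 0 < b by case/andP: b01.
  apply: (cvgn_eq _ (cvg_powRN0 b0)) => k.
  by rewrite /b opprB powRB ?k0 ?implybT// powRr1.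
have wl : k.+1%:R `^ al * hsum y k @[k --> \oo] --> g'^-1.
  rewrite -[g'^-1]subr0; apply: (cvgn_eq _ (cvgB (cvgV (lt0r_neq0 g'0) hg') w1)) => k /=.
  rewrite /hsum (cvg_lim _ (cy k))// mulrBr alE; congr (_ - _).
  rewrite !invfM mulrA; congr (_ * _).
  by rewrite /b powRB ?k0 ?implybT// powRr1// invf_div.
have [cx lx] := hsum_equiv x0 y0 xy cy' (fun k => powR_ge0 _ _) wl w1.
split=> //; have -> : pi / sin (pi * al) = (g * g')^-1 by rewrite ggE invf_div.
by rewrite invfM mulrA.
Unshelve. all: by end_near. Qed.
End hilbert_sums.

(** * Hilbert's inequality *)

Section schur.
Context {R : realType}.
Implicit Types (a x y : nat -> R).

Lemma cvg_powR (f : nat -> R) (l s : R) : 0 < s -> (forall n, 0 <= f n) ->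
  f n @[n --> \oo] --> l -> f n `^ s @[n --> \oo] --> l `^ s.
Proof.
move=> s0 f0 fl.
have l0 : 0 <= l by apply: (ler_cvg_to (cvg_cst 0) fl); near=> n.
(* Differentiability of the power is available only at [l > 0]; at 0 the limit is verified
   directly. *)
have [l1|l1] := eqVneq l 0; last first.
  have hc : {for l, continuous (@powR R ^~ s)}.
    apply/differentiable_continuous/derivable1_diffP.
    by apply: derivable_powR; rewrite in_itv/= andbT lt0r l1.
  exact: (cvg_comp _ _ fl hc).
rewrite l1 powR0 ?gt_eqF//; apply/cvgrPdist_le => e e0.
have /cvgrPdist_le/(_ _ (powR_gt0 s^-1 e0)) := fl.
apply: filterS => n; rewrite l1 !sub0r !normrN ger0_norm// ger0_norm ?powR_ge0// => h.
have -> : e = (e `^ s^-1) `^ s by rewrite -powRrM mulVf ?gt_eqF// powRr1// ltW.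
by rewrite ge0_ler_powR ?nnegrE ?powR_ge0// ltW.
Unshelve. all: by end_near. Qed.

(** The graph of [t^p] lies above its tangent at [m]; this is Young's inequality for [t] and
    [m^(p - 1)]. *)
Lemma powR_tangent (p t m : R) : 1 < p -> 0 <= t -> 0 <= m ->
  p * (t * m `^ (p - 1)) - (p - 1) * m `^ p <= t `^ p.
Proof.
move=> p1 t0 m0; have p0 : 0 < p by apply: lt_trans p1.
have := @conjugate_powR R t (m `^ (p - 1)) p (p / (p - 1)) t0 (powR_ge0 _ _) p0.
rewrite divr_gt0 ?subr_gt0// invf_div => /(_ isT).
have -> : p^-1 + (p - 1) / p = 1 by field; rewrite gt_eqF.
move=> /(_ erefl); rewrite -powRrM.
have -> : (p - 1) * (p / (p - 1)) = p by rewrite mulrCA divff ?mulr1 ?subr_eq0 ?gt_eqF.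
rewrite -(ler_pM2l p0) => h; rewrite lerBlDr; apply: le_trans h _.
by rewrite le_eqVlt; apply/orP; left; apply/eqP; field; rewrite gt_eqF.
Qed.

(** Jensen's inequality with unnormalised weights: the tangent inequality at the weighted mean
    [T / S] is summed against [l]. *)
Lemma jensen_powR (p : R) (l t : nat -> R) M : 1 < p ->
  (forall n, 0 < l n) -> (forall n, 0 <= t n) ->
  (\sum_(0 <= n < M) l n * t n) `^ p <=
  (\sum_(0 <= n < M) l n) `^ (p - 1) * \sum_(0 <= n < M) l n * t n `^ p.
Proof.
move=> p1 l0 t0; have p0 : 0 < p by apply: lt_trans p1.
case: M => [|M]; first by rewrite !big_geq// mulr0 powR0 ?gt_eqF.
set S := \sum_(0 <= n < M.+1) l n; set T := \sum_(0 <= n < M.+1) l n * t n.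
have S0 : 0 < S by rewrite /S big_nat_recl//= ltr_wpDr// sumr_ge0// => i _; exact: ltW.
have T0 : 0 <= T by rewrite sumr_ge0// => i _; rewrite mulr_ge0// ltW.
have m0 : 0 <= T / S by rewrite divr_ge0// ltW.
suff h : S * (T / S) `^ p <= \sum_(0 <= n < M.+1) l n * t n `^ p.
  apply: le_trans (ler_wpM2l (powR_ge0 _ _) h).
  rewrite powRM ?invr_ge0 ?(ltW S0)// !mulrA (mulrC _ S) mulr_powRB1 ?(ltW S0)//.
  by rewrite mulrAC -powRM ?invr_ge0 ?(ltW S0)// divff ?gt_eqF// powR1 mul1r.
have -> : S * (T / S) `^ p = p * (T * (T / S) `^ (p - 1)) - (p - 1) * (S * (T / S) `^ p).
  have TE : T * (T / S) `^ (p - 1) = S * (T / S) `^ p.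
    by rewrite -(mulr_powRB1 m0 p0) mulrA [S * _]mulrC divfK ?gt_eqF.
  by rewrite TE; ring.
move: (T / S) m0 => m m0.
rewrite /T /S !mulr_suml !mulr_sumr -sumrB; apply: ler_sum => n _.
apply: le_trans (ler_wpM2l (ltW (l0 n)) (powR_tangent p1 (t0 n) m0)).
rewrite le_eqVlt; apply/orP; left; apply/eqP; ring.
Qed.

(** Jensen's inequality with weights [x_n / (n + k)], applied to [a_n / x_n], followed by an
    exchange of the two sums. The constant [A] has to work only for outputs in [[N, K)]. *)
Lemma schur_test (p A : R) (rho x y a : nat -> R) N K M : 1 < p -> 0 <= A ->
  (forall n, 0 <= rho n) -> (forall n, 0 < x n) -> (forall n, 0 < y n) ->
  (forall n, 0 <= a n) ->
  (forall k, (N <= k < K)%N -> \sum_(0 <= n < M) hterm x k n <= A * y k) ->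
  (forall n, \sum_(N <= k < K) rho k * y k `^ (p - 1) / (n.+1 + k.+1)%:R <= rho n * x n `^ (p - 1)) ->
  \sum_(N <= k < K) rho k * (\sum_(0 <= n < M) hterm a k n) `^ p <=
  A `^ (p - 1) * \sum_(0 <= n < M) rho n * a n `^ p.
Proof.
move=> p1 A0 r0 x0 y0 a0 hx hy; have p0 : 0 < p by apply: lt_trans p1.
have xn n : x n != 0 by rewrite gt_eqF.
apply: (@le_trans _ _ (\sum_(N <= k < K) \sum_(0 <= n < M)
   A `^ (p - 1) * (rho k * y k `^ (p - 1) / (n.+1 + k.+1)%:R * (x n `^ (1 - p) * a n `^ p)))).
  apply: ler_sum_nat => k kNK.
  apply: (@le_trans _ _ (rho k * ((A * y k) `^ (p - 1) * \sum_(0 <= n < M) hterm x k n * (a n / x n) `^ p))).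
    rewrite ler_wpM2l//; apply: le_trans (_ : (\sum_(0 <= n < M) hterm x k n * (a n / x n)) `^ p <= _).
      rewrite le_eqVlt; apply/orP; left; apply/eqP; congr (_ `^ _); apply: eq_bigr => n _.
      by rewrite /hterm mulrAC mulrCA divff ?mulr1.
    apply: le_trans (jensen_powR _ p1 _ _) _.
    - by move=> n; rewrite divr_gt0.
    - by move=> n; rewrite divr_ge0// ltW.
    rewrite ler_wpM2r//.
      by apply: sumr_ge0 => n _; rewrite mulr_ge0 ?powR_ge0// hterm_ge0// => j; exact: ltW.
    rewrite ge0_ler_powR ?subr_ge0 ?(ltW p1) ?nnegrE ?hx//.
      by apply: sumr_ge0 => n _; rewrite hterm_ge0// => j; exact: ltW.
    by rewrite mulr_ge0// ltW.
  rewrite !mulr_sumr; apply: ler_sum => n _.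
  rewrite le_eqVlt; apply/orP; left; apply/eqP.
  rewrite powRM ?(ltW (y0 _))// powRM ?invr_ge0 ?(ltW (x0 _))//.
  have -> : (x n)^-1 `^ p = x n `^ (1 - p) / x n.
    rewrite powRB ?xn ?implybT// powRr1 ?(ltW (x0 _))// mulrAC divff// mul1r.
    by rewrite -powR_inv1 ?(ltW (x0 _))// -powRrM mulN1r powRN.
  rewrite /hterm; have : (n.+1 + k.+1)%:R != 0 :> R by rewrite pnatr_eq0.
  by move: (n.+1 + k.+1)%:R => D D0; field; rewrite ?xn ?D0.
rewrite exchange_big_nat//= mulr_sumr; apply: ler_sum => n _.
rewrite -mulr_sumr ler_wpM2l ?powR_ge0// -mulr_suml.
apply: le_trans (ler_wpM2r _ (hy n)) _; first by rewrite mulr_ge0 ?powR_ge0.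
rewrite le_eqVlt; apply/orP; left; apply/eqP.
rewrite -mulrA; congr (_ * _); rewrite mulrA -powRD ?xn ?implybT//.
by rewrite (_ : p - 1 + (1 - p) = 0) ?powRr0 ?mul1r//; ring.
Qed.
End schur.

Section hilbert.
Context {R : realType} (p : R) (p1 : 1 < p).
Implicit Types (a x y : nat -> R).

Let p0 : 0 < p. Proof. exact: lt_trans p1. Qed.
Let q0 : 0 < p - 1. Proof. by rewrite subr_gt0. Qed.
Let pn0 : p != 0. Proof. by rewrite gt_eqF. Qed.
Let qn0 : p - 1 != 0. Proof. by rewrite gt_eqF. Qed.

Definition rho (n : nat) : R := n.+1%:R `^ (p - 2).

Definition hconst : R := pi / sin (pi / p).

Lemma rho_gt0 n : 0 < rho n. Proof. by rewrite powR_gt0. Qed.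

Lemma hconst_gt0 : 0 < hconst.
Proof.
rewrite divr_gt0 ?pi_gt0// sin_gt0_pi// divr_gt0 ?pi_gt0//=.
by rewrite ltr_pdivrMr// ltr_pMr ?pi_gt0.
Qed.

Let pi01 : 0 < p^-1 < 1. Proof. by rewrite invr_gt0 p0 invf_lt1. Qed.
Let al := 1 - p^-1.
Let al01 : 0 < al < 1.
Proof. by case/andP: pi01 => h1 h2; rewrite /al subr_gt0 h2 gtrBl. Qed.

Let cE : pi / sin (pi * al) = hconst.
Proof.
by rewrite /al mulrBr mulr1 sinB sinpi cospi mul0r sub0r mulN1r opprK.
Qed.

Let u n := rising p^-1 n.+1.
Let v k := rising al k.+1.
Let u0 n : 0 < u n. Proof. by rewrite rising_gt0 ?invr_gt0. Qed.
Let v0 n : 0 < v n. Proof. by rewrite rising_gt0//; case/andP: al01. Qed.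

Let X n := (n.+1%:R * u n * rho n) `^ (- (p - 1)^-1).
Let Y k := (v k / rho k) `^ ((p - 1)^-1).
Let X0 n : 0 < X n. Proof. by rewrite powR_gt0// !mulr_gt0// rho_gt0. Qed.
Let Y0 n : 0 < Y n. Proof. by rewrite powR_gt0// divr_gt0// rho_gt0. Qed.

Let XE n : rho n * X n `^ (p - 1) = (n.+1%:R * u n)^-1.
Proof.
rewrite /X -powRrM mulNr mulVf// powR_inv1 ?mulr_ge0 ?(ltW (u0 n)) ?(ltW (rho_gt0 n))//.
by rewrite [in LHS]invfM mulrCA divff ?mulr1// gt_eqF ?rho_gt0.
Qed.

Let YE k : rho k * Y k `^ (p - 1) = v k.
Proof.
rewrite /Y -powRrM mulVf// powRr1 ?divr_ge0 ?(ltW (v0 k)) ?(ltW (rho_gt0 k))//.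
by rewrite mulrC divfK// gt_eqF ?rho_gt0.
Qed.

Let Xasymp : exists2 g, 0 < g & exists2 g', 0 < g' & [/\ g * g' = hconst^-1,
  n.+1%:R `^ al * X n @[n --> \oo] --> g `^ (- (p - 1)^-1) &
  n.+1%:R `^ al * Y n @[n --> \oo] --> g' `^ ((p - 1)^-1)].
Proof.
have [g g0 hg] := rising_asymp pi01; have [g' g'0 hg'] := rising_asymp al01.
exists g => //; exists g' => //.
have N0 n : 0 < n.+1%:R :> R by [].
have Nn0 n : n.+1%:R != 0 :> R by [].
split.
- rewrite -cE invf_div; apply: (cvg_unique _ (cvgM hg hg')) => //.
  have := rising_product_cvg al01; apply: cvg_trans; apply: near_eq_cvg.
  near=> n; rewrite /al subKr /= mulrACA -powRD ?Nn0 ?implybT// (_ : 1 - p^-1 + p^-1 = 1) ?subrK// powRr1//.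
  by rewrite -mulrA (mulrC (rising (1 - p^-1) _)).
- have h n : 0 <= n.+1%:R `^ (1 - p^-1) * rising p^-1 n.+1 by rewrite mulr_ge0 ?powR_ge0// ltW// u0.
  have q'0 : 0 < (p - 1)^-1 by rewrite invr_gt0.
  have gn0 : g `^ (p - 1)^-1 != 0 by rewrite gt_eqF ?powR_gt0.
  rewrite powRN; apply: (cvgn_eq _ (cvgV gn0 (cvg_powR q'0 h hg))) => n.
  rewrite /X /= -powRN -/(u n) powRM ?powR_ge0 ?(ltW (u0 n))//.
  rewrite [in RHS]mulrAC powRM ?mulr_ge0 ?(ltW (u0 n)) ?(ltW (rho_gt0 n))// mulrA; congr (_ * _).
  have -> : n.+1%:R * rho n = n.+1%:R `^ (p - 1).
    rewrite /rho -{1}[n.+1%:R]powRr1// -powRD ?Nn0 ?implybT//; congr (_ `^ _); ring.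
  rewrite -!powRrM -powRD ?Nn0 ?implybT//; congr (_ `^ _).
  by rewrite /al; field; rewrite pn0 qn0.
- have h n : 0 <= n.+1%:R `^ (1 - al) * rising al n.+1 by rewrite mulr_ge0 ?powR_ge0// ltW// v0.
  have q'0 : 0 < (p - 1)^-1 by rewrite invr_gt0.
  apply: (cvgn_eq _ (cvg_powR q'0 h hg')) => n.
  rewrite /Y -/(v n) powRM ?powR_ge0 ?(ltW (v0 n))// mulrC.
  rewrite powRM ?invr_ge0 ?(ltW (v0 n)) ?(ltW (rho_gt0 n))// mulrCA; congr (_ * _).
  rewrite /rho -powRN -!powRrM -powRD ?Nn0 ?implybT//; congr (_ `^ _).
  by rewrite /al; field; rewrite pn0 qn0.
Unshelve. all: by end_near. Qed.

(** The limit is [(g g')^(-1/(p-1)) * hconst] with [g g' = 1 / hconst]; the power [p - 1] in Schur's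
    test turns it into [hconst^p]. *)
Let Xcvg : (forall k, cvgn (series (hterm X k))) /\
  hsum X k / Y k @[k --> \oo] --> hconst `^ (p / (p - 1)).
Proof.
have [g g0 [g' g'0 [gg hX hY]]] := Xasymp.
have [cX hs] := hsum_asymp al01 (fun n => ltW (X0 n)) hX; split=> //.
have gn0 : g' `^ (p - 1)^-1 != 0 by rewrite gt_eqF ?powR_gt0.
have -> : hconst `^ (p / (p - 1)) = g `^ (- (p - 1)^-1) * (pi / sin (pi * al)) / g' `^ (p - 1)^-1.
  rewrite cE powRN mulrAC -invfM -powRM ?(ltW g0) ?(ltW g'0)// gg.
  rewrite -powRN -[hconst^-1]powR_inv1 ?(ltW hconst_gt0)// -powRrM mulrNN mul1r.
  rewrite -{3}[hconst]powRr1 ?(ltW hconst_gt0)// -powRD ?(lt0r_neq0 hconst_gt0) ?implybT//.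
  by congr (_ `^ _); field; rewrite qn0.
apply: (cvgn_eq _ (cvgM hs (cvgV gn0 hY))) => n /=.
by rewrite invfM mulrACA divff ?mul1r// gt_eqF// powR_gt0.
Qed.

(** [r k] is the ratio in the output condition of Schur's test. A global bound on [r] gives
    boundedness, and its limit gives the sharp constant for tails. *)
Lemma hilbert_of_ratio : exists r : nat -> R,
  [/\ forall k, 0 <= r k, r k @[k --> \oo] --> hconst `^ (p / (p - 1)) &
  forall A N K M a, 0 <= A -> (forall k, (N <= k)%N -> r k <= A) -> (forall n, 0 <= a n) ->
  \sum_(N <= k < K) rho k * (\sum_(0 <= n < M) hterm a k n) `^ p <=
  A `^ (p - 1) * \sum_(0 <= n < M) rho n * a n `^ p].
Proof.
have [cX hr] := Xcvg.
have nd k : nondecreasing_seq (series (hterm X k)).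
  by apply: nondecreasing_series => n _ _; apply: hterm_ge0 => j; exact: ltW.
exists (fun k => hsum X k / Y k); split=> //.
  move=> k; rewrite divr_ge0 ?(ltW (Y0 k))//.
  apply: le_trans (nondecreasing_cvgn_le (nd k) (cX k) 0).
  by rewrite /series/= big_geq.
move=> A N K M a A0 hA a0.
apply: (schur_test (x := X) (y := Y)) => //.
- by move=> n; rewrite ltW// rho_gt0.
- move=> k /andP[Nk _]; have := hA _ Nk; rewrite ler_pdivrMr//; apply: le_trans.
  exact: nondecreasing_cvgn_le (nd k) (cX k) M.
move=> n; rewrite XE.
have hc := @hsum_rising _ al n al01.
have al1 : 1 - al = p^-1 by rewrite /al subKr.
rewrite al1 -/(u n) in hc.
have ndv : nondecreasing_seq (series (hterm v n)).
  by apply: nondecreasing_series => k _ _; apply: hterm_ge0 => j; exact: ltW.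
apply: (@le_trans _ _ (\sum_(0 <= k < K) hterm v n k)).
  have [NK|KN] := leqP N K; last first.
    by rewrite big_geq ?(ltnW KN)// sumr_ge0// => k _; apply: hterm_ge0 => j; exact: ltW.
  rewrite [leRHS](big_cat_nat _ NK)//= ler_wpDl//.
    by rewrite sumr_ge0// => k _; apply: hterm_ge0 => j; exact: ltW.
  by apply: ler_sum => k _; rewrite YE /hterm addnC.
have cv : cvgn (series (hterm v n)) by apply/cvg_ex; eexists; exact: hc.
apply: le_trans (nondecreasing_cvgn_le ndv cv K) _.
by rewrite (cvg_lim _ hc)// gerBl invr_ge0.
Qed.

Lemma hilbert_tail e : 0 < e -> exists N, forall K M a, (forall n, 0 <= a n) ->
  \sum_(N <= k < K) rho k * (\sum_(0 <= n < M) hterm a k n) `^ p <=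
  (hconst `^ p + e) * \sum_(0 <= n < M) rho n * a n `^ p.
Proof.
move=> e0; have [r [r0 hr hH]] := hilbert_of_ratio.
pose c1 := hconst `^ (p / (p - 1)).
have c1E : c1 `^ (p - 1) = hconst `^ p by rewrite -powRrM divfK.
have := cvg_powR q0 r0 hr; rewrite -/c1 c1E => /cvgrPdist_le/(_ _ e0)[N _ hN].
exists N => K M a a0.
have A0 : 0 <= hconst `^ p + e by rewrite addr_ge0 ?powR_ge0// ltW.
have -> : hconst `^ p + e = ((hconst `^ p + e) `^ (p - 1)^-1) `^ (p - 1).
  by rewrite -powRrM mulVf// powRr1.
apply: hH => //; first exact: powR_ge0.
move=> k /hN/=; rewrite ler_distlC => /andP[_ h].
have -> : r k = (r k `^ (p - 1)) `^ (p - 1)^-1 by rewrite -powRrM divff// powRr1.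
by rewrite ge0_ler_powR ?nnegrE ?powR_ge0// invr_ge0 ltW.
Qed.

Lemma hilbert_bounded : exists2 C : R, 0 < C & forall K M a, (forall n, 0 <= a n) ->
  \sum_(0 <= k < K) rho k * (\sum_(0 <= n < M) hterm a k n) `^ p <=
  C * \sum_(0 <= n < M) rho n * a n `^ p.
Proof.
have [r [r0 hr hH]] := hilbert_of_ratio.
have /cvg_seq_bounded/bounded_fun_has_ubound[C hC] : cvgn r by apply/cvg_ex; eexists; exact: hr.
have C0 : 0 <= C by apply: le_trans (r0 0%N) _; apply: hC; exists 0%N.
exists (C `^ (p - 1) + 1); first by rewrite ltr_wpDl ?powR_ge0.
move=> K M a a0; apply: le_trans (hH C _ _ _ _ _ _ _) _ => //.
  by move=> k _; apply: hC; exists k.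
rewrite ler_wpM2r ?lerDl// sumr_ge0// => n _; rewrite mulr_ge0 ?powR_ge0//.
Qed.
End hilbert.

(** * The operators on the Hardy-Littlewood space *)

Section complex_sequences.
Context {R : realType}.
Local Notation nc := (@Normc.normc R).
Implicit Types (z w : R[i]) (f : nat -> R[i]^o).

Lemma normrE_nc (z : R[i]) : `|z| = (nc z)%:C%C.
Proof. by rewrite normc_def; case: z. Qed.

Lemma nc_ge0 (z : R[i]) : 0 <= nc z.
Proof. by case: z => x y; exact: sqrtr_ge0. Qed.

Lemma ncD (z w : R[i]) : nc (z + w) <= nc z + nc w.
Proof. exact: le_normcD. Qed.

Lemma nc_real (x : R) : nc x%:C%C = `|x|.
Proof. by rewrite /= expr0n/= addr0 sqrtr_sqr. Qed.

Lemma nc_Re (z : R[i]) : `|complex.Re z| <= nc z.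
Proof. by case: z => x y /=; rewrite -sqrtr_sqr ler_wsqrtr// lerDl sqr_ge0. Qed.

Lemma nc_Im (z : R[i]) : `|complex.Im z| <= nc z.
Proof. by case: z => x y /=; rewrite -sqrtr_sqr ler_wsqrtr// lerDr sqr_ge0. Qed.

Lemma nc_le (x y : R) : nc (x +i* y)%C <= `|x| + `|y|.
Proof.
rewrite /= -[leRHS]ger0_norm ?addr_ge0// -sqrtr_sqr ler_wsqrtr// sqrrD !real_normK ?num_real//.
by rewrite lerD2r lerDl mulrn_wge0// mulr_ge0.
Qed.

Lemma cvgC_P f (l : R[i]^o) : f n @[n --> \oo] --> l <->
  forall e : R, 0 < e -> \forall n \near \oo, nc (l - f n) <= e.
Proof.
split=> [/cvgrPdist_le h e e0|h].
  have /h : 0 < e%:C%C :> R[i] by rewrite ltcR.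
  by apply: filterS => n; rewrite normrE_nc lecR.
apply/cvgrPdist_le => e e0.
have eE : e = (complex.Re e)%:C%C by rewrite RRe_real// ger0_real// ltW.
have : 0 < complex.Re e by rewrite -ltcR -eE.
by move=> /h; apply: filterS => n; rewrite eE -lecR -normrE_nc.
Qed.

Lemma cvg_complex (x y : nat -> R) (l m : R) :
  x n @[n --> \oo] --> l -> y n @[n --> \oo] --> m ->
  ((x n +i* y n)%C : R[i]^o) @[n --> \oo] --> ((l +i* m)%C : R[i]^o).
Proof.
move=> /cvgrPdist_le xl /cvgrPdist_le ym; apply/cvgC_P => e e0.
have e2 : 0 < e / 2 by rewrite divr_gt0.
near=> n.
have -> : (l +i* m - (x n +i* y n))%C = ((l - x n) +i* (m - y n))%C by [].
apply: le_trans (nc_le _ _) _; rewrite (splitr e) lerD//; near: n.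
  exact: xl.
exact: ym.
Unshelve. all: by end_near. Qed.

Lemma cvgC_nc_le f (l : R[i]^o) (C : R) : f n @[n --> \oo] --> l ->
  (forall n, nc (f n) <= C) -> nc l <= C.
Proof.
move=> /cvgC_P fl fC; apply/ler_addgt0Pr => e /fl [N _ /(_ N (leqnn _))] /= h.
have -> : l = f N + (l - f N) by rewrite addrC subrK.
by apply: le_trans (ncD _ _) _; rewrite lerD.
Qed.

End complex_sequences.

(** * Norms through finite real sums *)

Section HLnorm_real.
Context {R : realType} (p : R) (p1 : 1 < p).
Local Notation nc := (@Normc.normc R).
Implicit Types (a b g : nat -> R[i]^o).

Let p0 : 0 < p. Proof. exact: lt_trans p1. Qed.

Let rho0 n : 0 <= rho p n. Proof. exact: powR_ge0. Qed.

Definition psum (x : nat -> R) (M : nat) : R := \sum_(0 <= n < M) rho p n * x n `^ p.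

Lemma psum_ge0 x M : 0 <= psum x M.
Proof. by apply: sumr_ge0 => n _; rewrite mulr_ge0 ?powR_ge0. Qed.

Lemma psum_nd x : nondecreasing_seq (psum x).
Proof.
by apply: nondecreasing_series => n _ _; rewrite mulr_ge0 ?powR_ge0.
Qed.

Lemma psumZ x (c : R) M : 0 <= c -> (forall n, 0 <= x n) ->
  psum (fun n => c * x n) M = c `^ p * psum x M.
Proof.
move=> c0 x0; rewrite /psum mulr_sumr; apply: eq_bigr => n _.
by rewrite powRM// mulrCA.
Qed.

Lemma ler_psum (x y : nat -> R) M : (forall n, 0 <= x n) -> (forall n, x n <= y n) ->
  psum x M <= psum y M.
Proof.
move=> x0 xy; apply: ler_sum => n _; rewrite ler_wpM2l//.
by rewrite ge0_ler_powR ?(ltW p0) ?nnegrE// (le_trans (x0 n)).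
Qed.

Lemma HLnorm_leP a (r : R) : 0 <= r ->
  (HLnorm p a <= r%:E)%E <-> forall M, psum (nc \o a) M <= r `^ p.
Proof.
move=> r0.
pose t n := ((nc (a n) `^ p * n.+1%:R `^ (p - 2))%:E : \bar R).
have t0 n : (0 <= t n)%E by rewrite lee_fin mulr_ge0 ?powR_ge0.
have psumE M : (psum (nc \o a) M)%:E = (\sum_(0 <= n < M) t n)%E.
  by rewrite /psum -sumEFin; apply: eq_bigr => n _; rewrite /t mulrC.
have rE : (r%:E = ((r `^ p)%:E `^ p^-1))%E.
  by rewrite poweR_EFin -powRrM divff ?gt_eqF// powRr1.
have pi0 : 0 <= p^-1 by rewrite invr_ge0 ltW.
have S0 : (0 <= \sum_(0 <= n <oo) t n)%E by apply: nneseries_ge0 => n _ _; exact: t0.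
split=> [h M|h].
  rewrite -lee_fin psumE; apply: le_trans (nneseries_lim_ge M (fun n _ _ => t0 n)) _.
  have /(gt0_ler_poweR (ltW p0)) : (HLnorm p a <= r%:E)%E := h.
  rewrite !in_itv/= !leey !andbT HLnorm_ge0 lee_fin r0 => /(_ isT isT).
  by rewrite /HLnorm -poweRrM mulVf ?gt_eqF// poweRe1// poweR_EFin.
rewrite rE; apply: (gt0_ler_poweR pi0); rewrite ?in_itv/= ?leey ?andbT ?lee_fin ?powR_ge0//.
apply: lime_le; first by apply: is_cvg_nneseries => n _ _; exact: t0.
by near=> M; rewrite -psumE lee_fin.
Unshelve. all: by end_near. Qed.

Lemma HLnorm_mono a b : (forall n, nc (a n) <= nc (b n)) -> (HLnorm p a <= HLnorm p b)%E.
Proof.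
move=> ab; have := HLnorm_ge0 p b.
case E : (HLnorm p b) => [r| |]// r0; last by rewrite leey.
apply/HLnorm_leP => // M; apply: le_trans (_ : psum (nc \o b) M <= _).
  by apply: ler_psum => n //=; exact: nc_ge0.
by apply HLnorm_leP => //; rewrite E.
Qed.

End HLnorm_real.

Section hop.
Context {R : realType} (p : R) (p1 : 1 < p).
Local Notation nc := (@Normc.normc R).
Implicit Types (g : nat -> R[i]^o) (a b : HL p1) (x : nat -> R).

Let p0 : 0 < p. Proof. exact: lt_trans p1. Qed.
Let rho0 n : 0 < rho p n. Proof. exact: rho_gt0. Qed.

(** A single summand of Hilbert's inequality bounds the partial sums of the series at [k], uniformly
    in their length. *)
Lemma psum_is_cvg_hterm x T : (forall n, 0 <= x n) -> (forall M, psum p x M <= T) ->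
  forall k, cvgn (series (hterm x k)).
Proof.
move=> x0 xT k; have [C C0 hC] := hilbert_bounded p1.
have nd : nondecreasing_seq (series (hterm x k)).
  by apply: nondecreasing_series => n _ _; exact: hterm_ge0.
apply: nondecreasing_is_cvgn => //.
exists ((C * T / rho p k) `^ p^-1) => _ [M _ <-].
have s0 j : 0 <= series (hterm x j) M by apply: sumr_ge0 => n _; exact: hterm_ge0.
have -> : series (hterm x k) M = (series (hterm x k) M `^ p) `^ p^-1.
  by rewrite -powRrM divff ?gt_eqF// powRr1.
have h : rho p k * series (hterm x k) M `^ p <= C * T.
  apply: le_trans (ler_wpM2l (ltW C0) (xT M)).
  apply: le_trans (hC k.+1 M x x0); rewrite big_nat_recr//= lerDr.
  by apply: sumr_ge0 => j _; rewrite mulr_ge0 ?powR_ge0// ltW.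
have h2 : 0 <= C * T / rho p k.
  by rewrite divr_ge0 ?(ltW (rho0 k))//; apply: le_trans h; rewrite mulr_ge0 ?powR_ge0// ltW.
by rewrite ge0_ler_powR ?invr_ge0 ?(ltW p0) ?nnegrE ?powR_ge0// ler_pdivlMr// mulrC.
Qed.

Lemma hsum_ge0 x k : (forall n, 0 <= x n) -> cvgn (series (hterm x k)) -> 0 <= hsum x k.
Proof.
move=> x0 cx; have nd : nondecreasing_seq (series (hterm x k)).
  by apply: nondecreasing_series => n _ _; exact: hterm_ge0.
by apply: le_trans (nondecreasing_cvgn_le nd cx 0); rewrite /series/= big_geq.
Qed.

Lemma sum_hsum_le x (w : nat -> R) N K B : (forall n, 0 <= x n) ->
  (forall k, cvgn (series (hterm x k))) ->
  (forall M, \sum_(N <= k < K) w k * (\sum_(0 <= n < M) hterm x k n) `^ p <= B) ->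
  \sum_(N <= k < K) w k * hsum x k `^ p <= B.
Proof.
move=> x0 cx h.
have hc : \sum_(N <= k < K) w k * (series (hterm x k) M) `^ p @[M --> \oo] -->
    \sum_(N <= k < K) w k * hsum x k `^ p.
  apply: cvg_big => [|k _]; first exact: add_continuous. apply: cvgMl_tmp; apply: cvg_powR => //.
    by move=> n; apply: sumr_ge0 => j _; exact: hterm_ge0.
apply: (ler_cvg_to hc (cvg_cst B)); near=> M; exact: h.
Unshelve. all: by end_near. Qed.

Lemma HL_psum a : forall M, psum p (nc \o a) M <= fine (HLnorm p a) `^ p.
Proof.
apply HLnorm_leP => //; first exact: fine_ge0 (HLnorm_ge0 _ _).
by rewrite fineK// HLnorm_fin_num.
Qed.

Lemma HL_is_cvg a k : cvgn (series (hterm (nc \o a) k)).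
Proof.
by apply: (psum_is_cvg_hterm _ (HL_psum a)) => n; exact: nc_ge0.
Qed.

Lemma natrC n : n%:R = (n%:R : R)%:C%C :> R[i].
Proof. by rewrite rmorph_nat. Qed.

Lemma HtermE g (a : nat -> R[i]^o) k n : Hterm g a k n =
  (complex.Re (g k * a n) / (n.+1 + k.+1)%:R +i* (complex.Im (g k * a n) / (n.+1 + k.+1)%:R))%C.
Proof.
rewrite /Hterm natrC -fmorphV; move: (_^-1) => h; case: (g k * a n) => x y.
by apply/eqP; rewrite eq_complex /= !mulr0 subr0 add0r !eqxx.
Qed.

Lemma series_complex (x y : nat -> R) n :
  series (fun n => ((x n +i* y n)%C : R[i]^o)) n = (series x n +i* series y n)%C.
Proof.
elim: n => [|n IH]; first by rewrite /series/= !big_geq.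
by rewrite !seriesSr IH.
Qed.

(** Real and imaginary parts are dominated by the Hilbert series of [|a|]. This holds for every [g],
    so the limit in [Hop] is never a junk value. *)
Lemma Hop_cvg g a k : series (Hterm g a k) n @[n --> \oo] --> Hop p1 g a k.
Proof.
have dom (f : R[i] -> R) : (forall z, `|f z| <= nc z) ->
    cvgn (series (fun n => f (g k * a n) / (n.+1 + k.+1)%:R)).
  move=> fz; apply: normed_cvg.
  have cC : cvgn (series (nc (g k) *: hterm (nc \o a) k)).
    by apply: is_cvg_seriesZ; exact: HL_is_cvg.
  apply: series_le_cvg cC => n /=.
  - exact: normr_ge0.
  - by rewrite -[leRHS]/(_ * (_ / _)) !mulr_ge0 ?nc_ge0.
  rewrite -[leRHS]/(_ * (_ / _)) normrM normfV normr_nat mulrA ler_wpM2r//.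
  by rewrite /= -Normc.normcM.
have cRe := dom _ nc_Re; have cIm := dom _ nc_Im.
suff cS : cvgn (series (Hterm g a k)) by exact: cS.
apply/cvg_ex; eexists.
have -> : series (Hterm g a k) = fun n =>
  (series (fun n => complex.Re (g k * a n) / (n.+1 + k.+1)%:R) n
   +i* series (fun n => complex.Im (g k * a n) / (n.+1 + k.+1)%:R) n)%C.
  apply/funext => n; rewrite -series_complex; congr series.
  by apply/funext => j; rewrite HtermE.
exact: cvg_complex cRe cIm.
Qed.

Lemma nc_Hop_le g a k : nc (Hop p1 g a k) <= nc (g k) * hsum (nc \o a) k.
Proof.
apply: (cvgC_nc_le (@Hop_cvg g a k)) => n.
have nd : nondecreasing_seq (series (hterm (nc \o a) k)).
  by apply: nondecreasing_series => j _ _; apply: hterm_ge0 => ?; exact: nc_ge0.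
apply: le_trans (ler_wpM2l (nc_ge0 _) (nondecreasing_cvgn_le nd (@HL_is_cvg a k) n)).
elim: n => [|n IH]; first by rewrite /series/= !big_geq// mulr0 Normc.normc0.
rewrite !seriesSr mulrDr; apply: le_trans (ncD _ _) _; rewrite lerD//.
by rewrite /Hterm !Normc.normcM Normc.normcV natrC nc_real normr_nat -mulrA.
Qed.

(** Nonnegative inputs turn [nc_Hop_le] into an equality, so operator norms can be computed from
    [|g|] and nonnegative real sequences. *)
Lemma nc_Hop_nonneg g a x k : (forall n, a n = (x n)%:C%C) -> (forall n, 0 <= x n) ->
  nc (Hop p1 g a k) = nc (g k) * hsum x k.
Proof.
move=> ax x0; have E : nc \o a = x.
  by apply/funext => n; rewrite /= ax nc_real ger0_norm.
have cx : cvgn (series (hterm x k)) by rewrite -E; exact: HL_is_cvg.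
suff -> : Hop p1 g a k = g k * (hsum x k)%:C%C.
  by rewrite Normc.normcM nc_real ger0_norm// hsum_ge0.
apply: (cvg_unique (@norm_hausdorff _ _) (@Hop_cvg g a k)).
have -> : series (Hterm g a k) = fun n =>
  ((complex.Re (g k) * series (hterm x k) n) +i* (complex.Im (g k) * series (hterm x k) n))%C.
  apply/funext => n; rewrite /series/= !mulr_sumr -(series_complex (fun n => _ * hterm x k n) (fun n => _ * hterm x k n)).
  congr series; apply/funext => j; rewrite HtermE ax /hterm; case: (g k) => u v.
  by rewrite /= !mulr0 subr0 add0r !mulrA.
have -> : g k * (hsum x k)%:C%C = ((complex.Re (g k) * hsum x k) +i* (complex.Im (g k) * hsum x k))%C.
  by case: (g k) => u v; apply/eqP; rewrite eq_complex /= !mulr0 subr0 add0r !eqxx.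
by apply: cvg_complex; apply: cvgMl_tmp.
Qed.

Lemma Hop_linear g (c : R[i]) a b : Hop p1 g (c *: a + b) = c *: Hop p1 g a + Hop p1 g b.
Proof.
apply/funext => k.
have : series (Hterm g (c *: a + b) k) n @[n --> \oo] --> c *: Hop p1 g a k + Hop p1 g b k.
  have -> : series (Hterm g (c *: a + b) k) = c *: series (Hterm g a k) + series (Hterm g b k).
    rewrite -seriesZ -seriesD; congr series; apply/funext => n.
    rewrite /Hterm/= !fctE /GRing.scale/=.
    rewrite mulrDr mulrDl; congr (_ + _); rewrite !mulrA; congr (_ / _).
    by rewrite (mulrC (g k)).
  by apply: cvgD; [apply: cvgZl_tmp|]; exact: Hop_cvg.
by apply: (cvg_unique (@norm_hausdorff _ _)); exact: Hop_cvg.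
Qed.

End hop.

Section opnorm.
Context {R : realType} (p : R) (p1 : 1 < p).
Local Notation nc := (@Normc.normc R).
Implicit Types (g : nat -> R[i]^o) (a b : HL p1) (x : nat -> R).

Let p0 : 0 < p. Proof. exact: lt_trans p1. Qed.

Lemma opnorm_leP (A : HL p1 -> nat -> R[i]^o) (r : \bar R) :
  (opnorm A <= r)%E <-> forall a, (HLnorm p a <= 1)%E -> (HLnorm p (A a) <= r)%E.
Proof.
split=> [h a a1|h]; last by apply: ge_ereal_sup => _ [a a1 <-]; exact: h.
by apply: le_trans h; apply: ereal_sup_ubound; exists a.
Qed.

Lemma HLnorm0E : HLnorm p (0 : HL p1) = 0%E.
Proof. exact: HLnorm0. Qed.

Lemma opnorm_ge0 (A : HL p1 -> nat -> R[i]^o) : (0 <= opnorm A)%E.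
Proof.
apply: le_trans (HLnorm_ge0 p (A 0)) _; apply: ereal_sup_ubound; exists 0 => //=.
by rewrite HLnorm0E lee01.
Qed.

Lemma opnorm_Hop_le g (r : R) : 0 <= r ->
  (forall x, (forall n, 0 <= x n) -> (forall M, psum p x M <= 1) ->
    forall K, psum p (fun k => nc (g k) * hsum x k) K <= r `^ p) ->
  (opnorm (Hop p1 g) <= r%:E)%E.
Proof.
move=> r0 h; apply/opnorm_leP => a a1; apply/HLnorm_leP => // K.
have a1' M : psum p (nc \o a) M <= 1.
  suff : psum p (nc \o a) M <= 1 `^ p by rewrite powR1.
  by move: M; apply/HLnorm_leP.
apply: le_trans (h _ (fun n => nc_ge0 _) a1' K).
by apply: ler_psum => // k; [exact: nc_ge0|exact: nc_Hop_le].
Qed.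

Lemma hsumZ x (c : R) k : cvgn (series (hterm x k)) ->
  hsum (fun n => c * x n) k = c * hsum x k.
Proof.
move=> cx; rewrite /hsum -[RHS]/(c *: limn _) -lim_seriesZ//; congr (limn (series _)).
by apply/funext => n; rewrite /hterm -mulrA.
Qed.

Lemma HL_of_nonneg x (T : R) : (forall n, 0 <= x n) -> 0 <= T ->
  (forall M, psum p x M <= T `^ p) ->
  exists2 a : HL p1, (forall n, a n = (x n)%:C%C) & (HLnorm p a <= T%:E)%E.
Proof.
move=> x0 T0 hT.
have h : (HLnorm p (fun n => (x n)%:C%C : R[i]^o) <= T%:E)%E.
  apply/HLnorm_leP => // M; apply: le_trans (hT M); rewrite le_eqVlt; apply/orP; left; apply/eqP.
  by apply: eq_bigr => n _; rewrite -[(nc \o _) n]/(nc (x n)%:C%C) nc_real ger0_norm.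
have hp : (fun n => (x n)%:C%C : R[i]^o) \in HLpred p.
  by rewrite unfold_in /HLpred (le_lt_trans h)// ltry.
by exists (MkHL p1 hp).
Qed.

Lemma opnorm_Hop_ge g (r T : R) x : (opnorm (Hop p1 g) <= r%:E)%E -> 0 <= r ->
  (forall n, 0 <= x n) -> (forall M, psum p x M <= T) ->
  forall K, psum p (fun k => nc (g k) * hsum x k) K <= r `^ p * T.
Proof.
move=> hr r0 x0 xT K.
have cx := psum_is_cvg_hterm p1 x0 xT.
have T0 : 0 <= T by apply: le_trans (xT 0%N); exact: psum_ge0.
(* [T] may be 0, so the normalisation uses any [T' > 0] above it, and [T'] then descends to [T]. *)
suff H T' : 0 < T' -> T <= T' -> psum p (fun k => nc (g k) * hsum x k) K <= r `^ p * T'.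
  apply/ler_addgt0Pr => e e0.
  apply: le_trans (H (T + e / (r `^ p + 1)) _ _) _.
  - by rewrite ltr_wpDl// divr_gt0// ltr_wpDl ?powR_ge0.
  - by rewrite lerDl divr_ge0 ?(ltW e0)// addr_ge0 ?powR_ge0.
  rewrite mulrDr lerD2l mulrCA ler_piMr ?(ltW e0)//.
  by rewrite ler_pdivrMr ?mul1r ?lerDl// ltr_wpDl ?powR_ge0.
move=> T'0 TT'; pose c := T' `^ (- p^-1).
have cp : c `^ p = T'^-1.
  by rewrite -powRrM mulNr mulVf ?gt_eqF// powR_inv1// ltW.
have c0 : 0 <= c by exact: powR_ge0.
have y0 n : 0 <= c * x n by rewrite mulr_ge0.
have y1 M : psum p (fun n => c * x n) M <= 1 `^ p.
  rewrite psumZ// cp powR1 mulrC ler_pdivrMr// mul1r; exact: le_trans (xT M) TT'.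
have [a aE a1] := HL_of_nonneg y0 ler01 y1.
have := (opnorm_leP _ _).1 hr a a1 => /(HLnorm_leP p1 _ r0)/(_ K).
have -> : nc \o Hop p1 g a = fun k => c * (nc (g k) * hsum x k).
  by apply/funext => k; rewrite /= (nc_Hop_nonneg g k aE y0) hsumZ// mulrCA.
rewrite psumZ//; last by move=> k; rewrite mulr_ge0 ?nc_ge0// hsum_ge0.
by rewrite cp mulrC ler_pdivrMr.
Qed.

Lemma Hop_le_opnorm g (r : R) a : (opnorm (Hop p1 g) <= r%:E)%E -> 0 <= r ->
  (HLnorm p (Hop p1 g a) <= r%:E * HLnorm p a)%E.
Proof.
move=> hr r0; rewrite -(fineK (HLnorm_fin_num a)) -EFinM.
have s0 : 0 <= fine (HLnorm p a) by exact: fine_ge0 (HLnorm_ge0 _ _).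
apply/HLnorm_leP; rewrite ?mulr_ge0// => K; rewrite powRM//.
apply: le_trans (opnorm_Hop_ge hr r0 (fun n => nc_ge0 _) (HL_psum a) K).
by apply: ler_psum => // k; [exact: nc_ge0|exact: nc_Hop_le].
Qed.

Definition tailC (N : nat) (a : nat -> R[i]^o) : nat -> R[i]^o :=
  fun k => if (k < N)%N then 0 else a k.

Definition headC (N : nat) (a : nat -> R[i]^o) : nat -> R[i]^o :=
  fun k => if (k < N)%N then a k else 0.

Lemma Hop_eq0 g a k : g k = 0 -> Hop p1 g a k = 0.
Proof.
move=> gk; rewrite /Hop (_ : series _ = fun=> 0); first exact: lim_cst.
by apply/funext => n; apply: big1 => j _; rewrite /Hterm gk !mul0r.
Qed.

Lemma Hop_eq g g' a k : g k = g' k -> Hop p1 g a k = Hop p1 g' a k.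
Proof. by move=> gk; rewrite /Hop /Hterm gk. Qed.

(** Truncating the output amounts to truncating [g], so the tails are operators of the same kind. *)
Lemma Hop_tailC N g a : Hop p1 (tailC N g) a = tailC N (Hop p1 g a).
Proof.
apply/funext => k; rewrite {2}/tailC; case: ifPn => kN.
  by apply: Hop_eq0; rewrite /tailC kN.
by apply: Hop_eq; rewrite /tailC (negbTE kN).
Qed.

Lemma headC_HLpred N (b : nat -> R[i]^o) : headC N b \in HLpred p.
Proof.
pose S := psum p (nc \o headC N b) N.
have S0 : 0 <= S `^ p^-1 by exact: powR_ge0.
rewrite unfold_in /HLpred (@le_lt_trans _ _ (S `^ p^-1)%:E) ?ltry//.
apply/HLnorm_leP => // M; rewrite -powRrM mulVf ?gt_eqF// powRr1 ?psum_ge0//.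
have [MN|NM] := leqP M N; first exact: psum_nd.
rewrite /S /psum (big_cat_nat _ (ltnW NM))//= gerDl big_nat_cond big1// => k.
move=> /andP[/andP[Nk _] _]; have -> : nc (headC N b k) = 0 by rewrite /headC ltnNge Nk Normc.normc0.
by rewrite powR0 ?gt_eqF// mulr0.
Qed.

End opnorm.

(** * Compactness and the essential norm *)

Section head_operator.
Context {R : realType} (p : R) (p1 : 1 < p).

Definition headop (N : nat) (g : nat -> R[i]^o) (a : HL p1) : HL p1 :=
  MkHL p1 (headC_HLpred p1 N (Hop p1 g a)).

Lemma headop_linear N g : linear (headop N g).
Proof.
move=> c a b; apply/val_inj; apply/funext => k.
rewrite -[LHS]/(headC N (Hop p1 g (c *: a + b)) k).
rewrite -[RHS]/(c * headC N (Hop p1 g a) k + headC N (Hop p1 g b) k).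
rewrite Hop_linear /headC; case: ifP => // _.
by rewrite mulr0 addr0.
Qed.

Definition headop_lin N g : {linear HL p1 -> HL p1} :=
  HB.pack (headop N g) (GRing.isLinear.Build R[i] (HL p1) (HL p1) *:%R (headop N g) (@headop_linear N g)).

End head_operator.

Section compactness.
Context {R : realType} (p : R) (p1 : 1 < p).
Local Notation nc := (@Normc.normc R).

Let p0 : 0 < p. Proof. exact: lt_trans p1. Qed.

Definition square (B : R) : set R[i]^o :=
  (fun z : R * R => ((z.1 +i* z.2)%C : R[i]^o)) @` (`[- B, B] `*` `[- B, B]).

Lemma square_compact B : compact (square B).
Proof.
apply: continuous_compact; last by apply: compact_setX; exact: segment_compact.
apply: continuous_subspaceT => -[x y].
apply/cvgrPdist_le => e e0.
have eE : e = (complex.Re e)%:C%C by rewrite RRe_real// ger0_real// ltW.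
have e1 : 0 < complex.Re e / 2 by rewrite divr_gt0// -ltcR -eE.
exists (ball x (complex.Re e / 2), ball y (complex.Re e / 2)).
  by split; exact: nbhsx_ballx.
move=> [x' y'] /= [bx by'].
rewrite normrE_nc eE lecR.
have -> : (x +i* y - (x' +i* y'))%C = ((x - x') +i* (y - y'))%C by [].
by apply: le_trans (nc_le _ _) _; rewrite (splitr (complex.Re e)) lerD// ltW.
Qed.

(** The indicator of [k] already vanishes beyond [k]; it is cut off there so that membership in the
    space comes from [headC_HLpred]. *)
Definition HLbasis (k : nat) : HL p1 :=
  MkHL p1 (headC_HLpred p1 k.+1 (fun j => (j == k)%:R)).

Lemma HLbasisE k j : HLbasis k j = (j == k)%:R.
Proof.
rewrite /= /headC; case: ltnP => // kj.
by rewrite gtn_eqF.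
Qed.

(* Written as an iterated image, so that compactness is immediate. *)
Fixpoint box (B : R) (N : nat) : set (HL p1) :=
  if N is M.+1 then
    (fun z : HL p1 * R[i]^o => z.1 + (z.2 : R[i]) *: HLbasis M) @` (box B M `*` square B)
  else [set 0].

Lemma box_compact B N : compact (box B N).
Proof.
elim: N => [|N IH]; first exact: compact_set1.
apply: continuous_compact; last by apply: compact_setX => //; exact: square_compact.
apply: continuous_subspaceT => z.
apply: cvgD; first exact: cvg_fst.
apply: cvgZr_tmp; exact: cvg_snd.
Qed.

Lemma box_mem B N (a : HL p1) : (forall k, (k < N)%N -> nc (a k) <= B) ->
  (forall k, (N <= k)%N -> a k = 0) -> box B N a.
Proof.
elim: N a => [|N IH] a aB a0.
  by apply/val_inj; apply/funext => k; exact: a0.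
exists (a - a N *: HLbasis N, a N); last by rewrite /= subrK.
have E k : (a - a N *: HLbasis N) k = a k - a N * (k == N)%:R.
  by rewrite -HLbasisE.
split=> /=.
  apply: IH => k kN; rewrite E.
    by rewrite ltn_eqF// mulr0 subr0 aB// ltnW.
  have [->|kN'] := eqVneq k N; first by rewrite mulr1 subrr.
  by rewrite mulr0 subr0 a0// ltn_neqAle eq_sym kN'.
exists (complex.Re (a N), complex.Im (a N)); last by case: (a N).
have := aB _ (ltnSn N) => h.
by split; rewrite /= in_itv/= -ler_norml (le_trans _ h)// ?nc_Re ?nc_Im.
Qed.

Lemma HL_norm_le1 (a : HL p1) : `|a| <= 1 -> (HLnorm p a <= 1)%E.
Proof.
rewrite HL_normE -[1 in X in X -> _]/(1%:C)%C lecR => h.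
by rewrite -(fineK (HLnorm_fin_num a)) lee_fin.
Qed.

Lemma headop_compact N g : compact_operator (headop_lin p1 N g).
Proof.
have [C C0 hC] := hilbert_bounded p1.
(* Each term bounds one output coordinate on the unit ball, by a single summand of Hilbert's
   inequality; the sum bounds all coordinates at once. *)
pose D := \sum_(0 <= k < N) nc (g k) * (C / rho p k) `^ p^-1.
have h : headop N g @` [set a : HL p1 | `|a| <= 1] `<=` box D N.
  move=> _ [a /= /HL_norm_le1 a1 <-]; apply: box_mem => k kN; last first.
    by rewrite /= /headC ltnNge kN.
  rewrite /= /headC kN; apply: le_trans (nc_Hop_le _ _ _) _.
  have D0 j : 0 <= nc (g j) * (C / rho p j) `^ p^-1.
    by rewrite mulr_ge0 ?nc_ge0 ?powR_ge0.
  apply: (@le_trans _ _ (nc (g k) * (C / rho p k) `^ p^-1)); last first.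
    rewrite /D big_mkord (bigD1 (Ordinal kN))//= lerDl sumr_ge0//.
  rewrite ler_wpM2l ?nc_ge0//.
  have x0 n : 0 <= (nc \o a) n by exact: nc_ge0.
  have cx k := @HL_is_cvg _ _ p1 a k.
  have a1' M : psum p (nc \o a) M <= 1.
    suff : psum p (nc \o a) M <= 1 `^ p by rewrite powR1.
    by move: M; apply/HLnorm_leP.
  have : \sum_(0 <= j < k.+1) rho p j * hsum (nc \o a) j `^ p <= C.
    apply: sum_hsum_le => // M; apply: le_trans (hC _ _ _ x0) _.
    by rewrite -[leRHS]mulr1 ler_wpM2l ?(ltW C0)//; exact: a1'.
  have hs0 := hsum_ge0 x0 (cx k).
  rewrite big_nat_recr//= => H.
  have {}H : hsum (nc \o a) k `^ p <= C / rho p k.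
    rewrite ler_pdivlMr ?rho_gt0// mulrC; apply: le_trans H; rewrite lerDr.
    by apply: sumr_ge0 => j _; rewrite mulr_ge0 ?powR_ge0.
  have -> : hsum (nc \o a) k = (hsum (nc \o a) k `^ p) `^ p^-1.
    by rewrite -powRrM divff ?gt_eqF// powRr1.
  by rewrite ge0_ler_powR ?invr_ge0 ?(ltW p0) ?nnegrE ?powR_ge0// divr_ge0 ?(ltW C0)// powR_ge0.
apply: (subclosed_compact (@closed_closure _ _) (@box_compact D N)).
have cl := compact_closed (@norm_hausdorff _ _) (@box_compact D N).
by apply: subset_trans (closureS h) _ => x /cl.
Qed.
End compactness.

Section essnorm.
Context {R : realType} (p : R) (p1 : 1 < p).
Local Notation nc := (@Normc.normc R).
Implicit Types (g : nat -> R[i]^o) (a b : HL p1).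

Let p0 : 0 < p. Proof. exact: lt_trans p1. Qed.

Lemma essnorm_le_tail N g : (essnorm (Hop p1 g) <= opnorm (Hop p1 (tailC N g)))%E.
Proof.
apply: ereal_inf_lbound; exists (headop_lin p1 N g); first exact: headop_compact.
congr opnorm; apply/funext => a; rewrite Hop_tailC; apply/funext => k.
rewrite -[LHS]/(Hop p1 g a k - headC N (Hop p1 g a) k) /headC /tailC.
by case: ifP => _; rewrite ?subrr ?subr0.
Qed.

Lemma HLnorm_tailC_le N (b : nat -> R[i]^o) : (HLnorm p (tailC N b) <= HLnorm p b)%E.
Proof.
apply: HLnorm_mono => // n; rewrite /tailC; case: ifP => // _.
by rewrite Normc.normc0 nc_ge0.
Qed.

Lemma psum_tailC N (b : nat -> R[i]^o) M :
  psum p (nc \o tailC N b) M = \sum_(0 <= k < M | (N <= k)%N) rho p k * nc (b k) `^ p.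
Proof.
rewrite /psum [RHS]big_mkcond; apply: eq_bigr => k _.
rewrite -[(nc \o _) k]/(nc (tailC N b k)) /tailC; case: leqP => // _.
by rewrite Normc.normc0 powR0 ?gt_eqF// mulr0.
Qed.

Lemma HLnorm_tail_small a (e : R) : 0 < e ->
  exists N, forall N', (N <= N')%N -> (HLnorm p (tailC N' a) <= e%:E)%E.
Proof.
move=> e0; pose S := psum p (nc \o a).
have Snd : nondecreasing_seq S by exact: psum_nd.
have cS : cvgn S.
  apply: nondecreasing_is_cvgn => //; exists (fine (HLnorm p a) `^ p) => _ [M _ <-].
  exact: HL_psum.
have ep : 0 < e `^ p by rewrite powR_gt0.
have /cvgrPdist_le/(_ _ ep)[N _ hN] := cS; exists N => N' NN'.
apply/HLnorm_leP => //; first exact: ltW.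
move=> M; rewrite psum_tailC; apply: le_trans (hN N' NN') => /=.
rewrite ger0_norm ?subr_ge0; last exact: nondecreasing_cvgn_le.
have [MN|NM] := leqP M N'.
  rewrite big_nat_cond big1; first by rewrite subr_ge0; exact: nondecreasing_cvgn_le.
  by move=> k /andP[/andP[_ kM] Nk]; have := leq_ltn_trans Nk kM; rewrite ltnNge MN.
rewrite (big_cat_nat _ (ltnW NM))//= [X in X + _]big_nat_cond big1 ?add0r; last first.
  by move=> k /andP[/andP[_ kN] Nk]; move: kN; rewrite ltnNge Nk.
apply: (@le_trans _ _ (S M - S N')); last by rewrite lerB// nondecreasing_cvgn_le.
have -> : S M = S N' + \sum_(N' <= k < M) rho p k * nc (a k) `^ p.
  by rewrite /S /psum (big_cat_nat _ (ltnW NM)).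
rewrite addrAC subrr add0r.
rewrite [leRHS]big_nat_cond [leLHS]big_nat_cond le_eqVlt; apply/orP; left; apply/eqP.
by apply: eq_bigl => k; case: (N' <= k)%N.
Qed.

(** Tail truncations tend to 0 at each point and are contractions, so smallness at a point persists
    on a ball around it for the same indices; the covering form of compactness makes the index
    uniform. *)
Lemma compact_tail_small (T : {linear HL p1 -> HL p1}) (e : R) :
  compact_operator T -> 0 < e ->
  exists N, forall a, (HLnorm p a <= 1)%E -> (HLnorm p (tailC N (T a)) <= e%:E)%E.
Proof.
move=> /compact_near_coveringP cT e0.
have [|N _ hN] := cT nat \oo (fun N y => (HLnorm p (tailC N (y : HL p1)) <= e%:E)%E) _.
  move=> x _; have e2 : 0 < e / 2 by rewrite divr_gt0.
  have [N hN] := HLnorm_tail_small x e2.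
  exists (ball x (e / 2)%:C%C, [set n | (N <= n)%N]).
    split => /=; last by exists N.
    by apply: nbhsx_ballx; rewrite ltcR.
  move=> [y n] /= [bxy Nn].
  have -> : tailC n y = tailC n x + tailC n (y - x : HL p1).
    apply/funext => k; rewrite -[RHS]/(tailC n x k + tailC n (y - x : HL p1) k) /tailC.
    case: ifP => _; first by rewrite addr0.
    by rewrite -[(_ - _ : HL p1) k]/(y k - x k) addrC subrK.
  apply: le_trans (ler_HLnormD p1 _ _) _; rewrite (splitr e) EFinD.
  apply: leeD; first exact: hN.
  apply: le_trans (HLnorm_tailC_le _ _) _.
  move: bxy; rewrite -ball_normE /= distrC HL_normE ltcR => /ltW.
  by rewrite -lee_fin fineK ?HLnorm_fin_num.
exists N => a a1; apply: (hN N) => //=; apply: subset_closure; exists a => //=.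
by rewrite HL_normE -[1]/(1%:C)%C lecR -lee_fin fineK ?HLnorm_fin_num.
Qed.

(** Truncation is a contraction and the tails of a compact [T] are small, so the norm of [H - T]
    bounds, up to [e], the norm of some tail of [H]. *)
Lemma essnorm_ge g (r : R) :
  (forall N s, 0 <= s -> (opnorm (Hop p1 (tailC N g)) <= s%:E)%E -> r <= s) ->
  (r%:E <= essnorm (Hop p1 g))%E.
Proof.
move=> h; apply: le_ereal_inf_tmp => _ [T cT <-].
have := opnorm_ge0 (fun a => Hop p1 g a - T a).
case E : (opnorm _) => [t| |]// t0; last by rewrite leey.
rewrite lee_fin in t0 *; apply/ler_addgt0Pr => e e0.
have [N hN] := compact_tail_small cT e0.
apply: (h N); first by rewrite addr_ge0 ?(ltW e0).
apply/opnorm_leP => a a1; rewrite Hop_tailC.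
have -> : tailC N (Hop p1 g a) = tailC N (Hop p1 g a - T a) + tailC N (T a).
  apply/funext => k; rewrite -[RHS]/(tailC N (Hop p1 g a - T a) k + tailC N (T a) k) /tailC.
  by case: ifP => _; rewrite ?addr0// -[(_ - _) k]/(Hop p1 g a k - T a k) subrK.
apply: le_trans (ler_HLnormD p1 _ _) _; rewrite EFinD.
apply: leeD; last exact: hN.
apply: le_trans (HLnorm_tailC_le _ _) _.
by apply (opnorm_leP (fun a => Hop p1 g a - T a) _).1 => //; rewrite E.
Qed.

Lemma essnorm_le g (r : R) :
  (forall e, 0 < e -> exists N, (opnorm (Hop p1 (tailC N g)) <= (r + e)%:E)%E) ->
  (essnorm (Hop p1 g) <= r%:E)%E.
Proof.
move=> h; apply/lee_addgt0Pr => e /h[N hN].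
exact: le_trans (essnorm_le_tail N g) hN.
Qed.

End essnorm.

(** * Block averages *)

Section windows.
Context {R : realType}.
Implicit Types (w f : nat -> R).

Definition slow (kap : R) f A B := forall j k, (A <= j < B)%N -> (A <= k < B)%N -> f k <= kap * f j.

Lemma sum_nat_const_mul (c : R) A B : (A <= B)%N -> \sum_(A <= j < B) c = (B%:R - A%:R) * c.
Proof. by move=> AB; rewrite big_const_nat iter_addr_0 -(mulr_natl c) natrB. Qed.

(** Multiplied by the length [B - A], both sides become double sums over the window, of [w_k f_k]
    and of [kap w_k f_j], which compare term by term. *)
Lemma window_le kap w f A B : (A < B)%N -> (forall k, 0 <= w k) -> slow kap f A B ->
  \sum_(A <= k < B) w k * f k <=
  kap * ((\sum_(A <= k < B) w k) / (B%:R - A%:R)) * \sum_(A <= k < B) f k.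
Proof.
move=> AB w0 sl.
have AB0 : 0 < B%:R - A%:R :> R by rewrite subr_gt0 ltr_nat.
rewrite -(ler_pM2l AB0) -sum_nat_const_mul; last exact: ltnW.
have -> : (B%:R - A%:R) * (kap * ((\sum_(A <= k < B) w k) / (B%:R - A%:R)) * \sum_(A <= k < B) f k)
    = \sum_(A <= j < B) \sum_(A <= k < B) w k * (kap * f j).
  under [RHS]eq_bigr do rewrite -mulr_suml; rewrite -!mulr_sumr.
  by move: AB0 (\sum_(_ <= _ < _) w _) (\sum_(_ <= _ < _) f _) => /lt0r_neq0; move: (B%:R - A%:R) => b b0 s t; field.
apply: ler_sum_nat => j jAB; apply: ler_sum_nat => k kAB.
by rewrite ler_wpM2l// sl.
Qed.

Lemma window_ge kap w f A B : (A < B)%N -> (forall k, 0 <= w k) -> slow kap f A B ->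
  ((\sum_(A <= k < B) w k) / (B%:R - A%:R)) * \sum_(A <= k < B) f k <=
  kap * \sum_(A <= k < B) w k * f k.
Proof.
move=> AB w0 sl.
have AB0 : 0 < B%:R - A%:R :> R by rewrite subr_gt0 ltr_nat.
rewrite -(ler_pM2l AB0).
have -> : (B%:R - A%:R) * (kap * (\sum_(A <= k < B) w k * f k)) =
    \sum_(A <= j < B) \sum_(A <= k < B) w k * (kap * f k).
  rewrite sum_nat_const_mul ?(ltnW AB)//; congr (_ * _); rewrite mulr_sumr.
  by apply: eq_bigr => k _; rewrite mulrCA.
have -> : (B%:R - A%:R) * ((\sum_(A <= k < B) w k) / (B%:R - A%:R) * \sum_(A <= k < B) f k)
    = \sum_(A <= j < B) \sum_(A <= k < B) w k * f j.
  under [RHS]eq_bigr do rewrite -mulr_suml; rewrite -mulr_sumr.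
  by rewrite mulrA mulrCA divff ?mulr1// gt_eqF.
apply: ler_sum_nat => j jAB; apply: ler_sum_nat => k kAB.
by rewrite ler_wpM2l// sl.
Qed.

Lemma sum_windows_le (D : nat -> nat) (f1 f2 : nat -> R) m n :
  {homo D : i j / (i <= j)%N} -> (m <= n)%N ->
  (forall i, (m <= i)%N -> \sum_(D i <= k < D i.+1) f1 k <= \sum_(D i <= k < D i.+1) f2 k) ->
  \sum_(D m <= k < D n) f1 k <= \sum_(D m <= k < D n) f2 k.
Proof.
move=> Dh mn h; elim: n mn => [|n IH].
  by rewrite leqn0 => /eqP ->; rewrite !big_geq.
rewrite leq_eqVlt => /predU1P[->|]; first by rewrite !big_geq.
rewrite ltnS => mn; rewrite !(@big_cat_nat _ _ _ (D n) (D m) (D n.+1)) ?Dh//=.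
by rewrite lerD// ?IH// h.
Qed.

End windows.

(** * Slow variation of sums against the Hilbert kernel *)

Section slow_variation.
Context {R : realType} (p : R) (p1 : 1 < p).
Implicit Types (x : nat -> R).

Let p0 : 0 < p. Proof. exact: lt_trans p1. Qed.

Lemma rhoE k : rho p k = k.+1%:R `^ p / k.+1%:R ^+ 2.
Proof. by rewrite /rho powRB ?pnatr_eq0 ?implybT// powR_mulrn. Qed.

(** The factor [r^p], from the growth of [y], is spent when [j <= k], and [r^2], from the squared
    index, when [k < j]; the product covers both orders. *)
Lemma slow_of_monotone (y : nat -> R) (r : R) A B : 1 <= r ->
  (forall k, 0 <= y k) ->
  (forall j k, (A <= j)%N -> (j <= k)%N -> (k < B)%N -> y j <= y k <= r * y j) ->
  (forall j k, (A <= j < B)%N -> (A <= k < B)%N -> k.+1%:R <= r * j.+1%:R) ->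
  slow (r `^ (p + 2)) (fun k => y k `^ p / k.+1%:R ^+ 2) A B.
Proof.
move=> r1 y0 hy hr j k jAB kAB.
have r0 : 0 <= r by apply: le_trans r1.
have rn0 : r != 0 by rewrite gt_eqF// (lt_le_trans ltr01).
have yp i : 0 <= y i `^ p / i.+1%:R ^+ 2 by rewrite divr_ge0 ?powR_ge0// exprn_ge0.
have rp : 1 <= r `^ p by rewrite -(powRr0 r) ler_powR// ltW.
rewrite powRD ?rn0 ?implybT// powR_mulrn//.
have [jk|kj] := leqP j k.
  have /andP[_ y2] := hy j k (andP jAB).1 jk (andP kAB).2.
  apply: (@le_trans _ _ (r `^ p * (y j `^ p / j.+1%:R ^+ 2))).
    rewrite mulrA -powRM// ler_pM ?powR_ge0 ?invr_ge0 ?exprn_ge0//.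
      by rewrite ge0_ler_powR ?(ltW p0) ?nnegrE// mulr_ge0.
    by rewrite lef_pV2 ?posrE ?exprn_gt0// lerXn2r ?nnegrE// ler_nat.
  by rewrite ler_wpM2r// ler_peMr ?powR_ge0// exprn_ege1.
have /andP[y2 _] := hy k j (andP kAB).1 (ltnW kj) (andP jAB).2.
apply: (@le_trans _ _ (r ^+ 2 * (y j `^ p / j.+1%:R ^+ 2))); last first.
  by rewrite ler_wpM2r// ler_peMl// exprn_ge0.
rewrite mulrCA ler_pM ?powR_ge0 ?invr_ge0 ?exprn_ge0//.
  by rewrite ge0_ler_powR ?(ltW p0) ?nnegrE.
rewrite -[X in X / _ ^+ 2]invrK -invfM lef_pV2 ?posrE ?mulr_gt0 ?invr_gt0 ?exprn_gt0// ?lt0r ?rn0//.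
by rewrite mulrC ler_pdivrMr ?exprn_gt0 ?lt0r ?rn0// -exprMn lerXn2r ?nnegrE ?mulr_ge0// mulrC hr.
Qed.

(** Multiplied by [|g_k|^p], this is the contribution of output [k] to the [p]-th power of the norm
    of [H_g x]; that power is thus linear in [|g|^p]. *)
Definition energy x k := rho p k * hsum x k `^ p.

Lemma hsum_mono x j k : (forall n, 0 <= x n) -> (forall k, cvgn (series (hterm x k))) ->
  (j <= k)%N -> hsum x k <= hsum x j.
Proof.
move=> x0 cx jk; apply: lim_series_le => // n.
by rewrite ler_wpM2l// lef_pV2 ?posrE// ler_nat leq_add2l.
Qed.

(** Each factor [k / (n + k)] increases with [k]. *)
Lemma hsum_scaled_mono x j k : (forall n, 0 <= x n) -> (forall k, cvgn (series (hterm x k))) ->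
  (j <= k)%N -> j.+1%:R * hsum x j <= k.+1%:R * hsum x k.
Proof.
move=> x0 cx jk; rewrite -[leLHS]/(_ *: limn _) -[leRHS]/(_ *: limn _).
rewrite -!lim_seriesZ//; apply: lim_series_le; [exact: is_cvg_seriesZ|exact: is_cvg_seriesZ|] => n.
rewrite -[leLHS]/(_ * (_ / _)) -[leRHS]/(_ * (_ / _)) !(mulrCA _ (x n)) ler_wpM2l//.
rewrite ler_pdivrMr// mulrAC ler_pdivlMr// -!natrM ler_nat.
by rewrite !mulnDr (mulnC j.+1 k.+1) leq_add2r leq_mul2r ltnS jk orbT.
Qed.

Lemma energy_ge0 x k : 0 <= energy x k.
Proof. by rewrite mulr_ge0 ?powR_ge0. Qed.

Lemma energy_slow x (r : R) A B : (forall n, 0 <= x n) -> (forall k, cvgn (series (hterm x k))) ->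
  1 <= r -> (forall j k, (A <= j < B)%N -> (A <= k < B)%N -> k.+1%:R <= r * j.+1%:R) ->
  slow (r `^ (p + 2)) (energy x) A B.
Proof.
move=> x0 cx r1 hr.
have h0 k : 0 <= hsum x k by exact: hsum_ge0.
have E k : energy x k = (k.+1%:R * hsum x k) `^ p / k.+1%:R ^+ 2.
  by rewrite /energy rhoE powRM// mulrAC.
have := @slow_of_monotone (fun k => k.+1%:R * hsum x k) r A B r1 _ _ hr.
move=> H j k jAB kAB; rewrite !E; apply: H => //.
- by move=> i; rewrite mulr_ge0.
- move=> i l Ai il lB; rewrite hsum_scaled_mono//=.
  rewrite mulrA; apply: ler_pM => //; last exact: hsum_mono.
  by apply: hr; rewrite ?Ai ?(leq_trans Ai)//= (leq_ltn_trans il).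
Qed.

Lemma rho_slow (r : R) A B : 1 <= r ->
  (forall j k, (A <= j < B)%N -> (A <= k < B)%N -> k.+1%:R <= r * j.+1%:R) ->
  slow (r `^ (p + 2)) (rho p) A B.
Proof.
move=> r1 hr j k jAB kAB; rewrite !rhoE.
apply: (@slow_of_monotone (fun k => k.+1%:R) r A B) => //.
move=> i l Ai il lB; rewrite ler_nat ltnS il/=.
by apply: hr; rewrite ?Ai ?(leq_trans Ai)//= (leq_ltn_trans il).
Qed.

End slow_variation.

(** * Blocks of a partition and the dyadic criterion *)

Section blocks.
Context {R : realType} (p : R) (p1 : 1 < p).
Local Notation nc := (@Normc.normc R).
Implicit Types (g : nat -> R[i]^o) (x : nat -> R).

Let p0 : 0 < p. Proof. exact: lt_trans p1. Qed.

Lemma psum_energy g x K : (forall k, 0 <= hsum x k) ->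
  psum p (fun k => nc (g k) * hsum x k) K = \sum_(0 <= k < K) nc (g k) `^ p * energy p x k.
Proof.
move=> h0; apply: eq_bigr => k _.
by rewrite powRM ?nc_ge0// /energy mulrCA.
Qed.

Lemma psum_energy_tailC N g x K : (forall k, 0 <= hsum x k) -> (N <= K)%N ->
  psum p (fun k => nc (tailC N g k) * hsum x k) K =
  \sum_(N <= k < K) nc (g k) `^ p * energy p x k.
Proof.
move=> h0 NK; rewrite psum_energy// (big_cat_nat _ NK)//=.
rewrite [X in X + _]big_nat_cond big1 ?add0r; last first.
  move=> k /andP[/andP[_ kN] _].
  by rewrite /tailC kN Normc.normc0 powR0 ?gt_eqF// mul0r.
by apply: eq_big_nat => k /andP[Nk _]; rewrite /tailC ltnNge Nk.
Qed.

Lemma tailC0 g : tailC 0 g = g.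
Proof. by []. Qed.

Section partition.
Context (d : nat -> nat).
Context (dh : {homo d : m n / (m < n)%N}).
Context (d0 : d 0%N = 1%N).

(* With 0-based indices, the n-th block of the partition is [blk n, blk n.+1). *)
Definition blk (n : nat) : nat := (d n).-1.

Lemma blkE n : d n = (blk n).+1.
Proof.
rewrite /blk prednK//; case: n => [|n]; first by rewrite d0.
exact: leq_ltn_trans (dh (ltn0Sn n)).
Qed.

Lemma blk_homo : {homo blk : m n / (m < n)%N}.
Proof. by move=> m n /dh; rewrite !blkE ltnS. Qed.

Lemma blk_nd : {homo blk : m n / (m <= n)%N}.
Proof.
move=> m n; rewrite leq_eqVlt => /predU1P[->//|/blk_homo]; exact: ltnW.
Qed.

Lemma leq_blk n : (n <= blk n)%N.
Proof. by elim: n => // n /leq_ltn_trans; apply; exact: blk_homo. Qed.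

Lemma blk0 : blk 0 = 0%N. Proof. by rewrite /blk d0. Qed.

Lemma GE g n : G p d g n =
  (\sum_(blk n <= k < blk n.+1) nc (g k) `^ p) / ((blk n.+1)%:R - (blk n)%:R).
Proof.
rewrite /G !blkE big_add1 /=; congr (_ / _).
by rewrite -!natr1 opprD addrACA subrr addr0.
Qed.

Lemma blk_ratio (r : R) n : 0 <= r -> (d n.+1)%:R <= r * (d n)%:R ->
  forall j k, (blk n <= j < blk n.+1)%N -> (blk n <= k < blk n.+1)%N -> k.+1%:R <= r * j.+1%:R.
Proof.
move=> r0 hr j k /andP[nj _] /andP[_ kn].
apply: (@le_trans _ _ (d n.+1)%:R); first by rewrite ler_nat blkE ltnW// ltnS.
by apply: le_trans hr _; rewrite ler_wpM2l// ler_nat blkE ltnS.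
Qed.

(** On each block the energy oscillates by a factor at most [r^(p+2)], so [|g|^p] may be replaced by
    its average, which is at most [S]. *)
Lemma blocks_upper g x m (r S B : R) : 1 <= r -> 0 <= S -> 0 <= B ->
  (forall n, 0 <= x n) -> (forall k, cvgn (series (hterm x k))) ->
  (forall n, (m <= n)%N -> (d n.+1)%:R <= r * (d n)%:R) ->
  (forall n, (m <= n)%N -> G p d g n <= S) ->
  (forall K, \sum_(blk m <= k < K) energy p x k <= B) ->
  forall K, psum p (fun k => nc (tailC (blk m) g k) * hsum x k) K <= r `^ (p + 2) * S * B.
Proof.
move=> r1 S0 B0 x0 cx hr hS hB K.
have h0 k : 0 <= hsum x k by exact: hsum_ge0.
have E0 k : 0 <= energy p x k by exact: energy_ge0.
(* The summation range is enlarged to whole blocks. *)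
apply: (@le_trans _ _ (psum p (fun k => nc (tailC (blk m) g k) * hsum x k) (blk (maxn m K)))).
  apply: psum_nd; apply: leq_trans (leq_blk _); exact: leq_maxr.
rewrite psum_energy_tailC ?blk_nd ?leq_maxl//.
have kap0 : 0 <= r `^ (p + 2) * S by rewrite mulr_ge0 ?powR_ge0.
apply: le_trans (ler_wpM2l kap0 (hB (blk (maxn m K)))); rewrite mulr_sumr.
apply: sum_windows_le => [||i mi]; [exact: blk_nd|exact: leq_maxl|].
have sl := energy_slow p1 x0 cx r1 (blk_ratio (le_trans ler01 r1) (hr i mi)).
have w0 k : 0 <= nc (g k) `^ p by exact: powR_ge0.
apply: le_trans (window_le (blk_homo (ltnSn i)) w0 sl) _.
rewrite -GE -mulr_sumr ler_wpM2r ?sumr_ge0// ler_wpM2l ?powR_ge0//.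
exact: hS.
Qed.

End partition.

Lemma energy_tail_bound x K B N : (forall n, 0 <= x n) -> (forall M, psum p x M <= 1) ->
  0 <= B ->
  (forall K M a, (forall n, 0 <= a n) ->
   \sum_(N <= k < K) rho p k * (\sum_(0 <= n < M) hterm a k n) `^ p <=
   B * \sum_(0 <= n < M) rho p n * a n `^ p) ->
  \sum_(N <= k < K) energy p x k <= B.
Proof.
move=> x0 x1 B0 h; have cx := psum_is_cvg_hterm p1 x0 x1.
apply: sum_hsum_le => // M; apply: le_trans (h K M x x0) _.
by rewrite -[leRHS]mulr1 ler_wpM2l//; exact: x1.
Qed.

Let dyadic := fun j : nat => (2 ^ j)%N.

Let dyadic_homo : {homo dyadic : m n / (m < n)%N}.
Proof. by move=> m n mn; rewrite /dyadic ltn_exp2l. Qed.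

Let dyadic_double n : (dyadic n.+1)%:R = 2 * (dyadic n)%:R :> R.
Proof. by rewrite /dyadic expnS natrM. Qed.

Lemma dyadic_upper : exists2 C : R, 0 < C & forall g (s : R), 0 <= s ->
  (forall j, G p dyadic g j <= s `^ p) -> (opnorm (Hop p1 g) <= (C * s)%:E)%E.
Proof.
have [C C0 hC] := hilbert_bounded p1.
exists ((2 `^ (p + 2) * C) `^ p^-1); first by rewrite powR_gt0// mulr_gt0// powR_gt0.
move=> g s s0 hs; apply: opnorm_Hop_le.
  by rewrite mulr_ge0// powR_ge0.
move=> x x0 x1 K.
have cx := psum_is_cvg_hterm p1 x0 x1.
have hB K' : \sum_(0 <= k < K') energy p x k <= C by apply: energy_tail_bound => //; exact: ltW.
rewrite powRM ?powR_ge0// -powRrM mulVf ?gt_eqF// powRr1; last first.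
  by rewrite mulr_ge0 ?powR_ge0// ltW.
rewrite mulrAC.
have := @blocks_upper dyadic dyadic_homo erefl g x 0 2 (s `^ p) C _ _ _ x0 cx _ _ _ K.
rewrite /blk/= tailC0; apply => //.
- by rewrite ler1n.
- exact: powR_ge0.
- exact: ltW.
- by move=> n _; rewrite dyadic_double.
Qed.

(** Tested on the indicator of the [j]-th block: there the kernel is at least [2^-(j+2)] and the
    block has [2^j] points, so the sums are at least 1/4 on it. The sum of [rho] over the block then
    appears on both sides and cancels. *)
Lemma dyadic_lower : exists2 C : R, 0 < C & forall g (r : R), 0 <= r ->
  (opnorm (Hop p1 g) <= r%:E)%E -> forall j, G p dyadic g j <= C * r `^ p.
Proof.
pose kap : R := 2 `^ (p + 2).
have kap0 : 0 < kap by rewrite powR_gt0.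
exists (kap * 4 `^ p); first by rewrite mulr_gt0// powR_gt0.
move=> g r r0 hr j.
pose A := blk dyadic j; pose B := blk dyadic j.+1.
have AB : (A < B)%N by exact: blk_homo.
pose x n : R := if (A <= n < B)%N then 1 else 0.
have x0 n : 0 <= x n by rewrite /x; case: ifP.
pose T := \sum_(A <= k < B) rho p k.
have T0 : 0 < T.
  by rewrite /T big_ltn// ltr_wpDr ?rho_gt0// sumr_ge0// => k _; rewrite powR_ge0.
have psx : psum p x B = T.
  rewrite /psum (big_cat_nat _ (ltnW AB))//= [X in X + _]big_nat_cond big1 ?add0r; last first.
    by move=> k /andP[/andP[_ kA] _]; rewrite /x leqNgt kA/= powR0 ?gt_eqF// mulr0.
  by apply: eq_big_nat => k kAB; rewrite /x kAB powR1 mulr1.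
have psT M : psum p x M <= T.
  have [MB|BM] := leqP M B; first by rewrite -psx; exact: psum_nd.
  rewrite -psx /psum (big_cat_nat _ (ltnW BM))//= gerDl big_nat_cond big1//.
  by move=> k /andP[/andP[Bk _] _]; rewrite /x ltnNge Bk andbF powR0 ?gt_eqF// mulr0.
have cx := psum_is_cvg_hterm p1 x0 psT.
have hx k : (A <= k < B)%N -> 4^-1 <= hsum x k.
  move=> kAB; have nd : nondecreasing_seq (series (hterm x k)).
    by apply: nondecreasing_series => n _ _; exact: hterm_ge0.
  apply: le_trans (nondecreasing_cvgn_le nd (cx k) B).
  rewrite /series/= (big_cat_nat _ (ltnW AB))//= ler_wpDl//.
    by rewrite sumr_ge0// => n _; exact: hterm_ge0.
  have jE : (B%:R - A%:R : R) = (2 ^ j)%:R.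
    rewrite -natrB ?(ltnW AB)// /A /B /blk /dyadic expnS mul2n -addnn.
    by congr _%:R; have := expn_gt0 2 j; lia.
  apply: (@le_trans _ _ (\sum_(A <= n < B) (2 ^ j.+2)%:R^-1)).
    rewrite sum_nat_const_mul ?(ltnW AB)// jE !expnS !natrM !invfM.
    have : (2 ^ j)%:R != 0 :> R by rewrite pnatr_eq0 expn_eq0.
    by move: (2 ^ j)%:R => E E0; rewrite le_eqVlt; apply/orP; left; apply/eqP; field.
  apply: ler_sum_nat => n nAB; rewrite /hterm /x nAB div1r lef_pV2 ?posrE ?ltr0n ?expn_gt0//.
  rewrite ler_nat; move: nAB kAB; rewrite /A /B /blk /dyadic !expnS.
  by have := expn_gt0 2 j; lia.
have := opnorm_Hop_ge hr r0 x0 psT B.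
have h0 k : 0 <= hsum x k by exact: hsum_ge0.
rewrite psum_energy// (big_cat_nat _ (ltnW AB))//= => H.
have {}H : \sum_(A <= k < B) nc (g k) `^ p * energy p x k <= r `^ p * T.
  apply: le_trans H; rewrite lerDr sumr_ge0// => k _.
  by rewrite mulr_ge0 ?powR_ge0// energy_ge0.
have {}H : 4^-1 `^ p * \sum_(A <= k < B) nc (g k) `^ p * rho p k <= r `^ p * T.
  apply: le_trans H; rewrite mulr_sumr; apply: ler_sum_nat => k kAB.
  rewrite mulrCA ler_wpM2l ?powR_ge0// mulrC ler_wpM2l ?powR_ge0//.
  by rewrite ge0_ler_powR ?(ltW p0) ?nnegrE// hx.
have sl : slow kap (rho p) A B.
  apply: rho_slow => //; first by rewrite ler1n.
  by apply: blk_ratio => //; rewrite dyadic_double.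
have w0 k : 0 <= nc (g k) `^ p by exact: powR_ge0.
have := window_ge AB w0 sl; rewrite -GE// -/T => H2.
rewrite -(ler_pM2r T0); apply: le_trans H2 _.
rewrite -!mulrA ler_wpM2l ?(ltW kap0)//.
have f0 : 0 < 4^-1 `^ p :> R by rewrite powR_gt0.
rewrite -(ler_pM2l f0); apply: le_trans H _.
rewrite mulrA -powRM// mulVf ?powR1 ?mul1r//.
Qed.

End blocks.

(** * Partitions with ratio tending to 1 *)

Section fine_partition.
Context {R : realType} (p : R) (p1 : 1 < p).
Local Notation nc := (@Normc.normc R).
Implicit Types (g : nat -> R[i]^o) (x : nat -> R).

Let p0 : 0 < p. Proof. exact: lt_trans p1. Qed.
Let pn0 : p != 0. Proof. by rewrite gt_eqF. Qed.

Context (d : nat -> nat).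
Context (dh : {homo d : m n / (m < n)%N}).
Context (d0 : d 0%N = 1%N).
Context (d1 : (d k.+1)%:R / (d k)%:R @[k --> \oo] --> (1 : R)).

Local Notation D := (blk d).

Let dpos n : 0 < (d n)%:R :> R. Proof. by rewrite (blkE dh d0) ltr0n. Qed.

Lemma ratio_near (e : R) : 0 < e ->
  \forall n \near \oo, (d n.+1)%:R <= (1 + e) * (d n)%:R.
Proof.
move=> e0; have /cvgrPdist_le/(_ _ e0) := d1; apply: filterS => n.
by rewrite ler_distlC => /andP[_]; rewrite ler_pdivrMr.
Qed.

Section limit.
Context (g : nat -> R[i]^o) (L : R).
Context (gL : G p d g n @[n --> \oo] --> L).

Lemma G_ge0 n : 0 <= G p d g n.
Proof.
rewrite GE// divr_ge0 ?sumr_ge0// => [k _|]; first exact: powR_ge0.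
by rewrite subr_ge0 ler_nat (blk_nd dh).
Qed.

Lemma limG_ge0 : 0 <= L.
Proof.
by apply: (ler_cvg_to (cvg_cst 0) gL); near=> n; exact: G_ge0.
Unshelve. all: by end_near. Qed.

Let cst := hconst p.
Let cst0 : 0 < cst. Proof. exact: hconst_gt0. Qed.

Let dlt0 n : 0 < n.+1%:R^-1 :> R. Proof. by rewrite invr_gt0. Qed.

Lemma essnorm_upper : (essnorm (Hop p1 g) <= (cst * L `^ p^-1)%:E)%E.
Proof.
have L0 := limG_ge0.
have cL0 : 0 <= cst * L `^ p^-1 by rewrite mulr_ge0 ?powR_ge0// ltW.
apply: essnorm_le => e e0.
have h0 : n.+1%:R^-1 @[n --> \oo] --> (0 : R) by exact: cvg_harmonic.
(* The errors in the block ratio, in the averages and in Hilbert's constant are given one common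
   size, so that a single limit controls all three. *)
have hphi : (1 + n.+1%:R^-1) `^ (p + 2) * (L + n.+1%:R^-1) * (cst `^ p + n.+1%:R^-1) @[n --> \oo] -->
    (1 + 0) `^ (p + 2) * (L + 0) * (cst `^ p + 0).
  apply: cvgM; last by apply: cvgD => //; exact: cvg_cst.
  apply: cvgM; last by apply: cvgD => //; exact: cvg_cst.
  apply: cvg_powR; first by rewrite addr_gt0.
    by move=> n; rewrite addr_ge0// ltW.
  by apply: cvgD => //; exact: cvg_cst.
pose t := (cst * L `^ p^-1 + e) `^ p.
have ht : (1 + 0) `^ (p + 2) * (L + 0) * (cst `^ p + 0) < t.
  rewrite !addr0 powR1 mul1r.
  have -> : L * cst `^ p = (cst * L `^ p^-1) `^ p.
    by rewrite powRM ?powR_ge0 ?(ltW cst0)// -powRrM mulVf// powRr1// mulrC.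
  rewrite /t gt0_ltr_powR ?nnegrE ?ltrDl// addr_ge0// ltW//.
have [n0 _ /(_ n0 (leqnn _)) /= hn0] : \forall n \near \oo,
    (1 + n.+1%:R^-1) `^ (p + 2) * (L + n.+1%:R^-1) * (cst `^ p + n.+1%:R^-1) <= t.
  by move/cvgr_le: hphi; apply.
move: (dlt0 n0) hn0; move: (n0.+1%:R^-1) => del del0 hdel.
have [N0 hN0] := hilbert_tail p1 del0.
have [m [mr mG mN]] : exists m, [/\ forall n, (m <= n)%N -> (d n.+1)%:R <= (1 + del) * (d n)%:R,
    forall n, (m <= n)%N -> G p d g n <= L + del & (N0 <= m)%N].
  have [m1 _ h1] := ratio_near del0.
  have /cvgrPdist_le/(_ _ del0)[m2 _ h2] := gL.
  exists (maxn N0 (maxn m1 m2)); split; last exact: leq_maxl.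
    by move=> n; rewrite !geq_max => /and3P[_ /h1].
  by move=> n; rewrite !geq_max => /and3P[_ _ /h2 /=]; rewrite ler_distlC => /andP[].
exists (D m); apply: opnorm_Hop_le => [|x x0 x1 K]; first by rewrite addr_ge0// ltW.
have cx := psum_is_cvg_hterm p1 x0 x1.
have B0 : 0 <= cst `^ p + del by rewrite addr_ge0 ?powR_ge0// ltW.
apply: le_trans hdel; apply: blocks_upper => //.
- by rewrite lerDl ltW.
- by rewrite addr_ge0// ltW.
move=> K'; apply: (@le_trans _ _ (\sum_(N0 <= k < K') energy p x k)); last first.
  by apply: energy_tail_bound.
have mD : (N0 <= D m)%N by apply: leq_trans mN (leq_blk dh d0 m).
have [DK|KD] := leqP (D m) K'.
  rewrite [leRHS](big_cat_nat _ DK)//= lerDr sumr_ge0// => k _.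
  by rewrite mulr_ge0 ?powR_ge0.
rewrite big_geq ?(ltnW KD)// sumr_ge0// => k _.
by rewrite mulr_ge0 ?powR_ge0.
Qed.

Let al : R := 1 - p^-1.
Let al01 : 0 < al < 1.
Proof.
have p1' : p^-1 < 1 by rewrite invf_lt1.
by rewrite /al subr_gt0 p1' gtrBl invr_gt0.
Qed.
Let al0 : 0 < al. Proof. by case/andP: al01. Qed.
(** The critical power: [rho n * X n^p] is the harmonic term, so the norms of its truncations are
    unbounded and fixed heads become negligible. *)
Let X (n : nat) : R := n.+1%:R `^ (- al).
Let X0 n : 0 <= X n. Proof. exact: powR_ge0. Qed.

Let Xasym : (forall k, cvgn (series (hterm X k))) /\
  k.+1%:R `^ al * hsum X k @[k --> \oo] --> cst.
Proof.
have hX : n.+1%:R `^ al * X n @[n --> \oo] --> (1 : R).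
  apply: (cvgn_eq _ (cvg_cst (1 : R))) => n.
  by rewrite /X powRN divff// gt_eqF// powR_gt0.
have [cX hs] := hsum_asymp al01 X0 hX; split=> //.
suff -> : cst = 1 * (pi / sin (pi * al)) by [].
by rewrite /cst /hconst /al mulrBr mulr1 sinB sinpi cospi mul0r sub0r mulN1r opprK mul1r.
Qed.

Let rhoX n : rho p n * X n `^ p = n.+1%:R^-1.
Proof.
rewrite /rho /X -powRrM -powRD ?pnatr_eq0 ?implybT// -powR_inv1//; congr (_ `^ _).
by rewrite /al; field.
Qed.

Let har (M : nat) : R := \sum_(0 <= k < M) k.+1%:R^-1.

Lemma har_unbounded (B : R) : exists n, forall k, (n <= k)%N -> B < har k.
Proof.
apply: contrapT => h; apply: (@dvg_harmonic R).
have nd : nondecreasing_seq (series (@harmonic R)).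
  by apply: nondecreasing_series => n _ _; exact: harmonic_ge0.
apply: nondecreasing_is_cvgn => //; exists B => _ [n _ <-].
rewrite leNgt; apply/negP => Bn; apply: h; exists n => k nk.
exact: lt_le_trans Bn (nd _ _ nk).
Qed.

Lemma leq_add_double a b c : (a <= b)%N -> (b.+1 + a <= 2 * (b.+1 + c.+1))%N.
Proof. clear; lia. Qed.

(* Test sequence: the extremal power [X], truncated at [A.+1 * d n]. *)
Lemma tail_lower_core N (s del : R) : 0 <= s -> 0 < del -> del + del <= cst ->
  (opnorm (Hop p1 (tailC N g)) <= s%:E)%E ->
  (cst - (del + del)) `^ p * (L - del) <= (1 + del) * s `^ p.
Proof.
move=> s0 del0 delc hs; have [cX hX] := Xasym.
have [C0 C00 hC0] : exists2 C : R, 0 <= C & forall k, k.+1%:R `^ al * hsum X k <= C.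
  have /cvg_seq_bounded/bounded_fun_has_ubound[C hC] : cvgn (fun k => k.+1%:R `^ al * hsum X k).
    by apply/cvg_ex; eexists; exact: hX.
  exists C; last by move=> k; apply: hC; exists k.
  have h : 0 <= 1%:R `^ al * hsum X 0 by rewrite mulr_ge0 ?powR_ge0// hsum_ge0.
  by apply: le_trans h _; apply: hC; exists 0%N.
(* With this [A], cutting [X] off at [A.+1 * d n] lowers the sums at outputs before [d n] by at most
   [del] relative to [k^(-al)]. *)
have [A hA] : exists A, 2 * C0 * A.+1%:R `^ (- al) <= del.
  have h : 2 * C0 * n.+1%:R `^ (- al) @[n --> \oo] --> 2 * C0 * 0.
    by apply: cvgMl_tmp; exact: cvg_powRN0.
  have /cvgrPdist_le/(_ _ del0)[n _ /(_ n (leqnn _))/=] := h.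
  by rewrite mulr0 sub0r normrN => /(le_trans (ler_norm _)) ?; exists n.
have [m [mr mG mN mX]] : exists m, [/\ forall n, (m <= n)%N -> (d n.+1)%:R <= (1 + del) * (d n)%:R,
    forall n, (m <= n)%N -> L - del <= G p d g n, (N <= D m)%N &
    forall k, (D m <= k)%N -> cst - del <= k.+1%:R `^ al * hsum X k].
  have [m1 _ h1] := ratio_near del0.
  have /cvgrPdist_le/(_ _ del0)[m2 _ h2] := gL.
  have /cvgrPdist_le/(_ _ del0)[m3 _ h3] := hX.
  exists (maxn N (maxn m1 (maxn m2 m3))); split.
  - by move=> n; rewrite !geq_max => /and4P[_ /h1].
  - by move=> n; rewrite !geq_max => /and4P[_ _ /h2 /=]; rewrite ler_distlC => /andP[].
  - apply: leq_trans (leq_blk dh d0 _); exact: leq_maxl.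
  move=> k hk; have : (m3 <= k)%N.
    by apply: leq_trans hk; apply: leq_trans (leq_blk dh d0 _); rewrite !leq_max leqnn !orbT.
  by move=> /h3 /=; rewrite ler_distlC => /andP[].
pose c2 := cst - (del + del); pose Y := c2 `^ p * (L - del); pose Z := (1 + del) * s `^ p.
have c20 : 0 <= c2 by rewrite subr_ge0.
have Z0 : 0 <= Z by rewrite mulr_ge0 ?powR_ge0// addr_ge0// ltW.
(* [har (D n)] is unbounded while the two corrections do not depend on [n], which forces
   [Y <= Z]. *)
suff key n : (m <= n)%N -> Y * (har (D n) - har (D m)) <= Z * (har (D n) + A.+1%:R).
  rewrite -/c2 -/Y -/Z leNgt; apply/negP => ZY.
  have YZ0 : 0 < Y - Z by rewrite subr_gt0.
  have [n0 hn0] := har_unbounded ((Z * A.+1%:R + Y * har (D m)) / (Y - Z)).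
  have := key (maxn m n0) (leq_maxl _ _).
  have /hn0 : (n0 <= D (maxn m n0))%N.
    by apply: leq_trans (leq_blk dh d0 _); exact: leq_maxr.
  rewrite ltr_pdivrMr//; nra.
move=> mn; pose M' := (A.+1 * d n)%N.
have M'0 : (0 < M')%N by rewrite muln_gt0 /= (blkE dh d0).
pose x k : R := if (k < M')%N then X k else 0.
have x0 k : 0 <= x k by rewrite /x; case: ifP.
have xX k : x k <= X k by rewrite /x; case: ifP.
have psx : psum p x M' = har M'.
  by apply: eq_big_nat => k /andP[_ kM]; rewrite /x kM rhoX.
have psT K : psum p x K <= har M'.
  have [KM|MK] := leqP K M'; first by rewrite -psx; exact: psum_nd.
  rewrite -psx /psum (big_cat_nat _ (ltnW MK))//= gerDl big_nat_cond big1//.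
  by move=> k /andP[/andP[Mk _] _]; rewrite /x ltnNge Mk powR0 ?gt_eqF// mulr0.
have cx := psum_is_cvg_hterm p1 x0 psT.
have h0 k : 0 <= hsum x k by exact: hsum_ge0.
(* For the removed indices [j >= M'] the kernel at [k] is at most twice the kernel at the output
   with 1-based index [M'], whatever [k] is. *)
have hXx k : hsum X k <= hsum x k + 2 * hsum X M'.-1.
  have -> : hsum x k + 2 * hsum X M'.-1 = limn (series (hterm x k + 2 *: hterm X M'.-1)).
    rewrite lim_seriesD; [|exact: cx|exact: is_cvg_seriesZ].
    by rewrite lim_seriesZ.
  apply: lim_series_le => //; first by apply: is_cvg_seriesD => //; exact: is_cvg_seriesZ.
  move=> j; rewrite -[leRHS]/(x j / _ + 2 * (X j / _)) /x; case: ltnP => Mj.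
    by rewrite lerDl mulr_ge0// divr_ge0.
  rewrite mul0r add0r prednK// mulrCA ler_wpM2l//.
  rewrite ler_pdivlMr ?ltr0n// mulrC ler_pdivrMr ?ltr0n//.
  by rewrite -[2 * _]natrM ler_nat; exact: leq_add_double.
have hx k : (D m <= k < D n)%N -> c2 * k.+1%:R `^ (- al) <= hsum x k.
  move=> /andP[mk kn]; have kal : 0 < k.+1%:R `^ al :> R by rewrite powR_gt0.
  rewrite powRN ler_pdivrMr// mulrC.
  have := mX k mk; have := hXx k; rewrite -(ler_pM2l kal) mulrDr => h1 h2.
  suff : k.+1%:R `^ al * (2 * hsum X M'.-1) <= del by rewrite /c2; lra.
  apply: le_trans hA; rewrite mulrCA -mulrA ler_wpM2l//.
  have M1 : 0 < (A.+1%:R * k.+1%:R) `^ al :> R by rewrite powR_gt0 ?mulr_gt0.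
  have h3 : (A.+1%:R * k.+1%:R) `^ al * hsum X M'.-1 <= C0.
    apply: le_trans (hC0 M'.-1); rewrite prednK// ler_wpM2r ?hsum_ge0//.
    rewrite ge0_ler_powR ?nnegrE ?(ltW al0)// -?natrM ?ler_nat//.
    by rewrite leq_mul2l /= (blkE dh d0) ltnS ltnW.
  by rewrite powRN ler_pdivlMr ?powR_gt0// mulrC mulrA -powRM.
have := opnorm_Hop_ge hs s0 x0 psT (D n).
have DmDn : (D m <= D n)%N by exact: (blk_nd dh).
rewrite psum_energy_tailC ?(leq_trans mN)// (@big_cat_nat _ _ _ (D m) N (D n)) //= => H.
have {}H : \sum_(D m <= k < D n) nc (g k) `^ p * energy p x k <= s `^ p * har M'.
  apply: le_trans H; rewrite lerDr sumr_ge0// => k _.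
  by rewrite mulr_ge0 ?powR_ge0// energy_ge0.
have {}H : c2 `^ p * (\sum_(D m <= k < D n) nc (g k) `^ p * k.+1%:R^-1) <= s `^ p * har M'.
  apply: le_trans H; rewrite mulr_sumr; apply: ler_sum_nat => k kmn.
  rewrite mulrCA ler_wpM2l ?powR_ge0// /energy -rhoX mulrCA ler_wpM2l ?powR_ge0//.
  by rewrite -powRM// ge0_ler_powR ?(ltW p0) ?nnegrE ?mulr_ge0// hx.
(* Between [D n] and [M'] there are at most [A.+1 * d n] terms, each at most [1 / d n]. *)
have hM : har M' <= har (D n) + A.+1%:R.
  have DM : (D n <= M')%N by rewrite /M' (blkE dh d0) mulSn; exact: leq_trans (leqnSn _) (leq_addr _ _).
  rewrite {1}/har (big_cat_nat _ DM)//= lerD2l.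
  apply: (@le_trans _ _ (\sum_(D n <= k < M') (d n)%:R^-1)).
    by apply: ler_sum_nat => k /andP[nk _]; rewrite lef_pV2 ?posrE// ler_nat (blkE dh d0) ltnS.
  rewrite sum_nat_const_mul// ler_pdivrMr// -natrM -/M' gerBl; exact: ler0n.
have HL : (L - del) * (har (D n) - har (D m)) <=
    (1 + del) * (\sum_(D m <= k < D n) nc (g k) `^ p * k.+1%:R^-1).
  have -> : har (D n) - har (D m) = \sum_(D m <= k < D n) k.+1%:R^-1.
    by rewrite /har (big_cat_nat _ DmDn)//= addrAC subrr add0r.
  rewrite !mulr_sumr; apply: sum_windows_le => //; first exact: (blk_nd dh).
  move=> i mi; rewrite -!mulr_sumr.
  have w0 k : 0 <= nc (g k) `^ p by exact: powR_ge0.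
  have sl : slow (1 + del) (fun k => k.+1%:R^-1) (D i) (D i.+1).
    move=> j k ji ki; have del1 : 0 <= 1 + del by rewrite addr_ge0// ltW.
    have := blk_ratio dh d0 del1 (mr i mi) ki ji.
    by move=> hjk; rewrite ler_pdivlMr// mulrC ler_pdivrMr// mulrC.
  apply: le_trans (window_ge (blk_homo dh d0 (ltnSn i)) w0 sl).
  rewrite -(GE p dh d0) ler_wpM2r ?mG// sumr_ge0// => k _.
apply: (@le_trans _ _ (Z * har M')); last by rewrite ler_wpM2l.
rewrite /Y -mulrA; apply: le_trans (ler_wpM2l (powR_ge0 _ _) HL) _.
by rewrite mulrCA /Z -mulrA ler_wpM2l// addr_ge0// ltW.
Qed.

Lemma essnorm_lower : ((cst * L `^ p^-1)%:E <= essnorm (Hop p1 g))%E.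
Proof.
have L0 := limG_ge0.
apply: essnorm_ge => N s s0 hs.
suff h : cst `^ p * L <= s `^ p.
  have -> : cst * L `^ p^-1 = (cst `^ p * L) `^ p^-1.
    by rewrite powRM ?powR_ge0// -powRrM divff// powRr1// ltW.
  have -> : s = (s `^ p) `^ p^-1 by rewrite -powRrM divff// powRr1.
  by rewrite ge0_ler_powR ?invr_ge0 ?(ltW p0) ?nnegrE ?mulr_ge0 ?powR_ge0.
(* The factor [cst / 2] ensures [del + del <= cst], as the core estimate requires. *)
pose del n : R := cst / 2 * n.+1%:R^-1.
have del0 n : 0 < del n by rewrite mulr_gt0 ?dlt0// divr_gt0.
have delc n : del n + del n <= cst.
  by rewrite -mulr2n -mulr_natr /del mulrAC divfK// ler_piMr ?(ltW cst0)// invf_le1 ?ltr0n// ler1n.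
have hd : del n @[n --> \oo] --> (0 : R).
  have h0 : n.+1%:R^-1 @[n --> \oo] --> (0 : R) by exact: cvg_harmonic.
  by rewrite -(mulr0 (cst / 2)); exact: cvgMl_tmp.
have hl : (cst - (del n + del n)) `^ p * (L - del n) @[n --> \oo] -->
    (cst - (0 + 0)) `^ p * (L - 0).
  apply: cvgM; last by apply: cvgB => //; exact: cvg_cst.
  apply: cvg_powR; [exact: p0|by move=> j; rewrite subr_ge0 delc|].
  by apply: cvgB; [exact: cvg_cst|exact: cvgD].
have hr : (1 + del n) * s `^ p @[n --> \oo] --> (1 + 0) * s `^ p.
  by apply: cvgMr_tmp; apply: cvgD => //; exact: cvg_cst.
have := ler_cvg_to hl hr; rewrite !addr0 !subr0 mul1r; apply.
by near=> n; exact: (tail_lower_core s0 (del0 n) (delc n) hs).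
Unshelve. all: by end_near. Qed.

End limit.
End fine_partition.

(** * Partitions with ratio tending to more than 1 *)

Section bounded.
Context {R : realType} (p : R) (p1 : 1 < p).
Local Notation nc := (@Normc.normc R).
Implicit Types (g : nat -> R[i]^o).

Let p0 : 0 < p. Proof. exact: lt_trans p1. Qed.
Let pn0 : p != 0. Proof. by rewrite gt_eqF. Qed.
Let dyadic := fun j : nat => (2 ^ j)%N.
Let dyadic_homo : {homo dyadic : m n / (m < n)%N}.
Proof. by move=> m n mn; rewrite /dyadic ltn_exp2l. Qed.

Lemma Hop_bounded_opnorm g (r : R) : 0 <= r -> (opnorm (Hop p1 g) <= r%:E)%E -> Hop_bounded p1 g.
Proof.
move=> r0 hr; split; last by exists r => a; exact: Hop_le_opnorm.
by move=> a k; apply/cvg_ex; eexists; exact: Hop_cvg.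
Qed.

Lemma opnorm_Hop_bounded g : Hop_bounded p1 g ->
  exists2 r : R, 0 <= r & opnorm (Hop p1 g) = r%:E.
Proof.
move=> [_ [M hM]].
have h : (opnorm (Hop p1 g) <= (Num.max M 0)%:E)%E.
  apply/opnorm_leP => a a1; apply: le_trans (hM a) _.
  rewrite -(fineK (HLnorm_fin_num a)) -EFinM lee_fin.
  have a0 : 0 <= fine (HLnorm p a) by exact: fine_ge0 (HLnorm_ge0 _ _).
  have a1' : fine (HLnorm p a) <= 1 by rewrite -lee_fin fineK// HLnorm_fin_num.
  apply: (@le_trans _ _ (Num.max M 0 * fine (HLnorm p a))).
    by rewrite ler_wpM2r// le_max lexx.
  by rewrite ler_piMr// le_max lexx orbT.
have := opnorm_ge0 (Hop p1 g); move: h.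
case: (opnorm _) => [r| |]// _; rewrite lee_fin => r0; by exists r.
Qed.

Lemma dyadic_bounded g (S : R) : 0 <= S -> (forall j, G p dyadic g j <= S) ->
  Hop_bounded p1 g.
Proof.
move=> S0 hS; have [C C0 hC] := dyadic_upper p1.
apply: (@Hop_bounded_opnorm g (C * S `^ p^-1)).
  by rewrite mulr_ge0 ?powR_ge0// ltW.
apply: hC; first exact: powR_ge0.
by move=> j; rewrite -powRrM mulVf// powRr1//; exact: hS.
Qed.

(** The factor 2 is the ratio of the end [2^(j+1)] of a dyadic block to its length. *)
Lemma linear_growth_bounded g (C : R) : 0 <= C ->
  (forall K, \sum_(0 <= k < K) nc (g k) `^ p <= C * K%:R) -> Hop_bounded p1 g.
Proof.
move=> C0 hC; apply: (@dyadic_bounded g (C * 2)); first by rewrite mulr_ge0.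
move=> j; rewrite GE//.
have AB : (blk dyadic j < blk dyadic j.+1)%N by exact: blk_homo.
have jE : ((blk dyadic j.+1)%:R - (blk dyadic j)%:R : R) = (2 ^ j)%:R.
  rewrite -natrB ?(ltnW AB)// /blk /dyadic expnS mul2n -addnn.
  by congr _%:R; have := expn_gt0 2 j; clear; lia.
rewrite jE ler_pdivrMr ?ltr0n ?expn_gt0// -mulrA -natrM -expnS.
apply: le_trans (_ : C * (blk dyadic j.+1)%:R <= _).
  apply: le_trans (hC _); rewrite [leRHS](big_cat_nat _ (ltnW AB))//= lerDr.
  by rewrite sumr_ge0// => k _; exact: powR_ge0.
by rewrite ler_wpM2l// ler_nat leq_pred.
Qed.

End bounded.

Section coarse_partition.
Context {R : realType} (p : R) (p1 : 1 < p).
Local Notation nc := (@Normc.normc R).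

Let p0 : 0 < p. Proof. exact: lt_trans p1. Qed.
Let pn0 : p != 0. Proof. by rewrite gt_eqF. Qed.

Context (d : nat -> nat).
Context (dh : {homo d : m n / (m < n)%N}).
Context (d0 : d 0%N = 1%N).

Local Notation D := (blk d).

Lemma block_of k : {n | (D n <= k < D n.+1)%N}.
Proof.
apply: cid; have ex : exists n, (k < D n.+1)%N by exists k; exact: leq_blk.
case: (ex_minnP ex) => n kn hmin; exists n; rewrite kn andbT.
case: n kn hmin => [|n] _ hmin; first by rewrite blk0.
by rewrite leqNgt; apply/negP => /hmin; rewrite ltnn.
Qed.

Definition block k : nat := projT1 (block_of k).

Lemma block_uniq n k : (D n <= k < D n.+1)%N -> block k = n.
Proof.
move=> /andP[nk kn]; rewrite /block; case: (block_of k) => m /= /andP[mk km].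
apply/eqP; rewrite eqn_leq; apply/andP; split; rewrite leqNgt; apply/negP => h.
  by have := leq_trans kn (leq_trans (blk_nd dh d0 h) mk); rewrite ltnn.
by have := leq_trans km (leq_trans (blk_nd dh d0 h) nk); rewrite ltnn.
Qed.

Context (lam : R) (n0 : nat).
Context (lam0 : 0 < lam).
Context (hlam : forall n, (n0 <= n)%N -> (1 + lam) * (d n)%:R <= (d n.+1)%:R).

Let msz n : R := (D n.+1)%:R - (D n)%:R.

Let mszE n : msz n = (d n.+1)%:R - (d n)%:R.
Proof.
by rewrite /msz !(blkE dh d0) -!natr1 opprD addrACA subrr addr0.
Qed.

Let msz0 n : 0 < msz n.
Proof. by rewrite subr_gt0 ltr_nat blk_homo. Qed.

(* The values of [|g|^p]: in block [n], [l n * d n] at the first point and the rest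
   of [msz n] at the last point, so that the block average is 1 whatever [l] is. *)
Definition masses (l : nat -> R) k : R :=
  (if k.+1 == D (block k).+1 then msz (block k) - l (block k) * (d (block k))%:R else 0) +
  (if k == D (block k) then l (block k) * (d (block k))%:R else 0).

Definition mass_seq (l : nat -> R) : nat -> R[i]^o := fun k => ((masses l k) `^ p^-1)%:C%C.

(** Mass is moved only from [n0] on, where the growth of [d] guarantees that block [n] has the mass
    [lam * d n] to give. *)
Definition late_share n : R := if (n0 <= n)%N then lam else 0.
Definition no_share (n : nat) : R := 0.

(** The second bound keeps the mass at the last point nonnegative; the first controls partial sums
    that end inside a block. *)
Definition admissible (l : nat -> R) := forall n, 0 <= l n <= lam /\ l n * (d n)%:R <= msz n.

Lemma late_share_admissible : admissible late_share.
Proof.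
move=> n; rewrite /late_share; case: ifP => [hn|_]; last first.
  by rewrite lexx ltW//= mul0r ltW.
rewrite lexx ltW//= mszE; split=> //; rewrite lerBrDr; apply: le_trans (hlam hn).
by rewrite mulrDl mul1r addrC.
Qed.

Lemma no_share_admissible : admissible no_share.
Proof. by move=> n; rewrite /no_share lexx ltW//= mul0r ltW. Qed.

Lemma masses_ge0 l k : admissible l -> 0 <= masses l k.
Proof.
move=> hl; have [/andP[h1 _] h2] := hl (block k).
by rewrite /masses addr_ge0//; case: ifP => // _; rewrite ?subr_ge0 ?mulr_ge0.
Qed.

Lemma nc_mass_seq l k : admissible l -> nc (mass_seq l k) `^ p = masses l k.
Proof.
move=> hl; rewrite /mass_seq nc_real ger0_norm ?powR_ge0//.
by rewrite -powRrM mulVf// powRr1// masses_ge0.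
Qed.

(** Valid also for a block with a single point, where [masses] adds its two contributions. *)
Lemma block_sum l (f : nat -> R) n : 
  \sum_(D n <= k < D n.+1) masses l k * f k =
  (msz n - l n * (d n)%:R) * f (D n.+1).-1 + l n * (d n)%:R * f (D n).
Proof.
have nn : (D n < D n.+1)%N by exact: blk_homo.
have E : \sum_(D n <= k < D n.+1) masses l k * f k =
   \sum_(D n <= k < D n.+1) ((if k == (D n.+1).-1 then (msz n - l n * (d n)%:R) * f k else 0) +
     (if k == D n then l n * (d n)%:R * f k else 0)).
  apply: eq_big_nat => k kn; rewrite /masses (block_uniq kn) mulrDl.
  have -> : (k.+1 == D n.+1) = (k == (D n.+1).-1).
    by rewrite -[in LHS](ltn_predK nn) eqSS.
  by congr (_ + _); case: ifP => _; rewrite ?mul0r.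
rewrite E big_split/= -!big_mkcond/=; congr (_ + _).
  by rewrite big_nat1_eq (_ : (_ && _) = true)//; move: nn; clear; lia.
by rewrite big_nat1_eq (_ : (_ && _) = true)//; move: nn; clear; lia.
Qed.

Lemma block_total l n : \sum_(D n <= k < D n.+1) masses l k = msz n.
Proof.
have := block_sum l (fun=> 1) n; rewrite !mulr1 subrK => <-.
by apply: eq_bigr => k _; rewrite mulr1.
Qed.

Lemma G_mass_seq l n : admissible l -> G p d (mass_seq l) n = 1.
Proof.
move=> hl; rewrite GE//; under eq_bigr do rewrite nc_mass_seq//.
by rewrite block_total divff// gt_eqF// msz0.
Qed.

Lemma sum_masses_blk l n : \sum_(0 <= k < D n) masses l k = (D n)%:R.
Proof.
elim: n => [|n IH]; first by rewrite blk0// big_geq.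
rewrite (@big_cat_nat _ _ _ (D n))//=; last exact: blk_nd.
by rewrite IH block_total /msz addrC subrK.
Qed.

(** Complete blocks contribute exactly their length; an incomplete one contributes at most its first
    mass, hence at most [lam * d n]. *)
Lemma sum_masses_le l K : admissible l -> \sum_(0 <= k < K) masses l k <= (1 + lam) * K%:R.
Proof.
move=> hl; have [n /andP[nK Kn]] := block_of K; have [/andP[h1 h1'] h2] := hl n.
rewrite (@big_cat_nat _ _ _ (D n))//= sum_masses_blk mulrDl mul1r lerD ?ler_nat//.
have -> : \sum_(D n <= k < K) masses l k = \sum_(D n <= k < K | k == D n) l n * (d n)%:R.
  rewrite [RHS]big_mkcond; apply: eq_big_nat => k /andP[nk kK].
  have kn : (D n <= k < D n.+1)%N by rewrite nk (ltn_trans kK Kn).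
  rewrite /masses (block_uniq kn) (ltn_eqF (leq_ltn_trans kK Kn)) add0r.
  by case: ifP.
rewrite big_nat1_eq leqnn /=; case: ifP => [nK'|_]; last first.
  by rewrite mulr_ge0// ltW.
by rewrite ler_pM// ler_nat (blkE dh d0).
Qed.

Lemma mass_seq_bounded l : admissible l -> Hop_bounded p1 (mass_seq l).
Proof.
move=> hl; apply: (@linear_growth_bounded _ _ _ _ (1 + lam)).
  by rewrite addr_ge0// ltW.
by move=> K; under eq_bigr do rewrite nc_mass_seq//; exact: sum_masses_le.
Qed.

(** Halfway between 1 and the asymptotic factor [1 + lam]; the margin absorbs the variation of the
    energy across the end of a block. *)
Let theta : R := 1 + lam / 2.
Let theta1 : 1 < theta. Proof. by rewrite ltrDl divr_gt0. Qed.
Let theta0 : 0 < theta. Proof. exact: lt_trans theta1. Qed.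

(** Around [d_(i+1)] the late share has mass [(d_(i+1) - d_i - lam d_i) + lam d_(i+1) = (1 + lam)
    (d_(i+1) - d_i)], against [d_(i+1) - d_i] without sharing; the part beyond the endpoint loses at
    most a factor [1 - eps]. The right-hand sum runs one block further to include the first point of
    block [n]. *)
Lemma masses_compare (f : nat -> R) m n (eps : R) : (n0 <= m)%N -> (m <= n)%N ->
  (forall k, 0 <= f k) -> 2 * eps * (1 + lam) = lam ->
  (forall n, (m <= n)%N -> (1 - eps) * f (D n.+1).-1 <= f (D n.+1)) ->
  theta * \sum_(D m <= k < D n) masses no_share k * f k <= \sum_(D m <= k < D n.+1) masses late_share k * f k.
Proof.
move=> n0m mn f0 heps hf.
have shareE i : (m <= i)%N -> late_share i = lam by move=> mi; rewrite /late_share (leq_trans n0m mi).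
have step l i : (m <= i)%N -> \sum_(D m <= k < D i.+1) masses l k * f k =
    \sum_(D m <= k < D i) masses l k * f k +
    ((msz i - l i * (d i)%:R) * f (D i.+1).-1 + l i * (d i)%:R * f (D i)).
  move=> mi; rewrite (@big_cat_nat _ _ _ (D i))//=; [|exact: blk_nd|exact: blk_nd].
  by rewrite block_sum.
(* The extra term is the mass at the first point of block [i]: not yet in the sum, but attached to
   the end of the preceding block. *)
have claim i : (m <= i)%N -> theta * \sum_(D m <= k < D i) masses no_share k * f k <=
    \sum_(D m <= k < D i) masses late_share k * f k + lam * (d i)%:R * f (D i).
  elim: i => [|i IH].
    rewrite leqn0 => /eqP ->; rewrite !big_geq// mulr0 add0r.
    by rewrite mulr_ge0// mulr_ge0// ltW.
  rewrite leq_eqVlt => /predU1P[->|].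
    by rewrite !big_geq// mulr0 add0r mulr_ge0// mulr_ge0// ltW.
  rewrite ltnS => mi; rewrite !step// shareE// /no_share !mul0r subr0 addr0 mulrDr.
  have := IH mi; have := hf i mi; have := f0 (D i.+1).-1.
  have := hlam (leq_trans n0m mi); rewrite mszE.
  have : 0 < (d i)%:R :> R by rewrite (blkE dh d0).
  move: ((d i)%:R : R) ((d i.+1)%:R : R) (f (D i.+1).-1) (f (D i.+1)) (f (D i)) => di di1 E E1 E0.
  move: (\sum_(_ <= _ < _) _ : R) (\sum_(_ <= _ < _) _ : R) => S2 S1 di0 hd E0' hE hS.
  have di10 : 0 < di1 by apply: lt_le_trans hd; rewrite mulr_gt0// addr_gt0.
  have h1 : lam * di1 * ((1 - eps) * E) <= lam * di1 * E1.
    by rewrite ler_wpM2l// mulr_ge0// ltW.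
  suff h2 : theta * ((di1 - di) * E) <= (di1 - di - lam * di) * E + lam * di1 * ((1 - eps) * E).
    lra.
  rewrite -subr_ge0; have -> : (di1 - di - lam * di) * E + lam * di1 * ((1 - eps) * E) - theta * ((di1 - di) * E)
    = (lam / 2 * (di1 - di) - lam * eps * di1) * E by rewrite /theta; field.
  rewrite mulr_ge0// subr_ge0.
  have lam1 : 0 < 1 + lam by rewrite addr_gt0.
  have epsE : eps = lam / (2 * (1 + lam)).
    by rewrite -{1}heps; field; rewrite gt_eqF.
  rewrite -(ler_pM2l lam1) -subr_ge0 epsE.
  have -> : (1 + lam) * (lam / 2 * (di1 - di)) - (1 + lam) * (lam * (lam / (2 * (1 + lam))) * di1)
    = lam / 2 * (di1 - (1 + lam) * di) by field; rewrite gt_eqF.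
  by rewrite mulr_ge0 ?subr_ge0// divr_ge0// ltW.
apply: le_trans (claim n mn) _; rewrite step// shareE// addrA lerD2r lerDl mulr_ge0//.
by have [_] := late_share_admissible n; rewrite shareE// subr_ge0.
Qed.

Lemma opnorm_compare N (s : R) : 0 <= s ->
  (opnorm (Hop p1 (tailC N (mass_seq late_share))) <= s%:E)%E ->
  exists N2, (opnorm (Hop p1 (tailC N2 (mass_seq no_share))) <= (theta `^ (- p^-1) * s)%:E)%E.
Proof.
(* With this [eps] the loss [lam * eps * d_(i+1)] is at most [lam / 2 * (d_(i+1) - d_i)], the margin
   between the factors [1 + lam] and [theta]. *)
move=> s0 hs; pose eps := lam / (2 * (1 + lam)).
have lam1 : 0 < 1 + lam by rewrite addr_gt0.
have heps : 2 * eps * (1 + lam) = lam by rewrite /eps; field; rewrite gt_eqF.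
have eps0 : 0 < eps by rewrite divr_gt0// mulr_gt0.
have eps1 : 0 < 1 - eps.
  by rewrite subr_gt0 /eps ltr_pdivrMr ?mulr_gt0//; lra.
(* Makes the oscillation bound [r^(p+2)] equal to [1 / (1 - eps)]. *)
pose r := (1 - eps)^-1 `^ (p + 2)^-1.
have p20 : 0 < p + 2 by rewrite addr_gt0.
have r1 : 1 < r.
  have -> : 1 = 1 `^ (p + 2)^-1 :> R by rewrite powR1.
  rewrite /r gt0_ltr_powR ?nnegrE ?invr_gt0 ?invr_ge0 ?(ltW eps1)//.
  by rewrite invf_gt1// gtrBl.
have rE : r `^ (p + 2) = (1 - eps)^-1.
  by rewrite /r -powRrM mulVf ?gt_eqF// powRr1// invr_ge0 ltW.
have [n1 hn1] : exists n, n.+1%:R^-1 <= r - 1.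
  have r10 : 0 < r - 1 by rewrite subr_gt0.
  have := @cvg_harmonic R => /cvgrPdist_le/(_ _ r10)[n _ /(_ n (leqnn _))] /=.
  by rewrite sub0r normrN => /(le_trans (ler_norm _)) ?; exists n.
pose m := maxn N (maxn n0 n1).
have Nm : (N <= D m)%N by apply: leq_trans (leq_blk dh d0 m); exact: leq_maxl.
have n0m : (n0 <= m)%N by rewrite !leq_max leqnn orbT.
have n1m : (n1 <= m)%N by rewrite !leq_max leqnn !orbT.
exists (D m); apply: opnorm_Hop_le; first by rewrite mulr_ge0 ?powR_ge0.
move=> x x0 x1 K; have cx := psum_is_cvg_hterm p1 x0 x1.
have h0 k : 0 <= hsum x k by exact: hsum_ge0.
have E0 k : 0 <= energy p x k by exact: energy_ge0.
have hE n : (m <= n)%N -> (1 - eps) * energy p x (D n.+1).-1 <= energy p x (D n.+1).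
  move=> mn; have nD := leq_blk dh d0 n.+1.
  have D0 : (0 < D n.+1)%N by exact: leq_ltn_trans nD.
  rewrite mulrC -ler_pdivlMr// mulrC -rE.
  (* The window consists of the two indices on either side of the endpoint; their ratio
     [(D + 1) / D] is at most [r] for [n >= n1]. *)
  apply: (energy_slow (A := (D n.+1).-1) (B := (D n.+1).+1) p1 x0 cx (ltW r1)).
  - move=> j k /andP[jD _] /andP[_ kD].
    apply: (@le_trans _ _ (r * (D n.+1)%:R)); last first.
      by rewrite ler_wpM2l ?(le_trans ler01 (ltW r1))// ler_nat; move: D0 jD; clear; lia.
    apply: (@le_trans _ _ (D n.+1).+1%:R); first by rewrite ler_nat.
    have : 1 <= (r - 1) * (D n.+1)%:R.
      apply: le_trans (_ : (n1.+1%:R^-1 * (D n.+1)%:R) <= _); last by rewrite ler_wpM2r.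
      rewrite mulrC ler_pdivlMr// mul1r ler_nat; apply: leq_trans nD.
      by rewrite ltnS (leq_trans n1m mn).
    rewrite -natr1; move: ((D n.+1)%:R : R) => DD; lra.
  - by move: D0; clear; lia.
  - by move: D0; clear; lia.
pose n := maxn m K.
have mn : (m <= n)%N by exact: leq_maxl.
have DD i : (m <= i)%N -> (D m <= D i)%N by move=> mi; exact: blk_nd.
apply: (@le_trans _ _ (psum p (fun k => nc (tailC (D m) (mass_seq no_share) k) * hsum x k) (D n))).
  apply: psum_nd; apply: leq_trans (leq_blk dh d0 _); exact: leq_maxr.
rewrite psum_energy_tailC ?DD//.
under eq_bigr do rewrite (nc_mass_seq _ no_share_admissible).
rewrite powRM ?powR_ge0// -powRrM mulNr mulVf// powR_inv1 ?(ltW theta0)//.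
rewrite mulrC ler_pdivlMr// mulrC.
apply: le_trans (masses_compare n0m mn E0 heps hE) _.
have := opnorm_Hop_ge hs s0 x0 x1 (D n.+1); rewrite mulr1; apply: le_trans.
have DmDn : (D m <= D n.+1)%N by rewrite DD// (leq_trans mn).
rewrite psum_energy_tailC ?(leq_trans Nm)// [leRHS](@big_cat_nat _ _ _ (D m))//=.
under [X in _ <= _ + X]eq_bigr do rewrite (nc_mass_seq _ late_share_admissible).
by rewrite lerDr sumr_ge0// => k _; rewrite mulr_ge0 ?powR_ge0.
Qed.

(** A factor above 1 gives a contradiction only if the essential norm is not 0. The last point of
    block [n] carries a mass at least [lam / (1 + lam)] times its index, which keeps the average
    over the dyadic block containing it away from 0. *)
Lemma opnorm_mass_positive : exists2 r : R, 0 < r & forall N s, 0 <= s ->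
  (opnorm (Hop p1 (tailC N (mass_seq no_share))) <= s%:E)%E -> r <= s.
Proof.
have [C C0 hC] := dyadic_lower p1.
have lam1 : 0 < 1 + lam by rewrite addr_gt0.
have q0 : 0 < lam / (1 + lam) by rewrite divr_gt0.
exists ((lam / (1 + lam) / C) `^ p^-1); first by rewrite powR_gt0// divr_gt0.
move=> N s s0 hs.
(* [K] is the 1-based index of the last point of block [n], so [2^j <= K < 2^(j+1)] locates its
   dyadic block. *)
pose n := maxn n0 N; pose K := D n.+1; pose j := trunc_log 2 K.
have nD : (D n < K)%N by exact: blk_homo.
have K0 : (0 < K)%N by exact: leq_ltn_trans nD.
have j1 : (2 ^ j <= K)%N by exact: trunc_logP.
have j2 : (K < 2 ^ j.+1)%N by exact: trunc_log_ltn.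
have NK : (N <= K.-1)%N.
  have : (n < K)%N by exact: leq_ltn_trans (leq_blk dh d0 n) nD.
  have : (N <= n)%N by exact: leq_maxr.
  by clear; lia.
have Kn : (D n <= K.-1 < D n.+1)%N by rewrite -/K; move: nD; clear; lia.
have mK : masses no_share K.-1 = msz n.
  by rewrite /masses (block_uniq Kn) prednK// eqxx /no_share mul0r subr0 if_same addr0.
have dy_homo : {homo (fun j : nat => (2 ^ j)%N) : m n / (m < n)%N}.
  by move=> a b ab; rewrite ltn_exp2l.
have := hC _ s s0 hs j; rewrite GE//.
set A := blk _ j; set B := blk _ j.+1.
have AB : (A < B)%N by exact: blk_homo.
have jE : (B%:R - A%:R : R) = (2 ^ j)%:R.
  rewrite -natrB ?(ltnW AB)// /A /B /blk expnS mul2n -addnn.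
  by congr _%:R; have := expn_gt0 2 j; clear; lia.
have KAB : (A <= K.-1 < B)%N.
  by rewrite /A /B /blk; move: K0 j1 j2 (expn_gt0 2 j); clear; lia.
rewrite jE => hG.
have {}hG : lam / (1 + lam) <= C * s `^ p.
  apply: le_trans hG; rewrite ler_pdivlMr ?ltr0n ?expn_gt0//.
  apply: (@le_trans _ _ (msz n)).
    apply: (@le_trans _ _ (lam / (1 + lam) * (d n.+1)%:R)).
      rewrite ler_wpM2l ?(ltW q0)// ler_nat (leq_trans j1)// (blkE dh d0).
      exact: leqnSn.
    rewrite mszE -(ler_pM2l lam1) mulrA mulrCA divff ?gt_eqF// mulr1.
    have := hlam (leq_maxl n0 N); rewrite -/n; lra.
  rewrite (big_cat_nat (n := K.-1)) ?(ltnW (andP KAB).2) ?(andP KAB).1//=.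
  rewrite [X in _ + X]big_ltn ?(andP KAB).2//.
  have -> : nc (tailC N (mass_seq no_share) K.-1) `^ p = msz n.
    by rewrite /tailC ltnNge NK nc_mass_seq ?mK//; exact: no_share_admissible.
  rewrite addrCA lerDl addr_ge0// sumr_ge0// => k _; exact: powR_ge0.
have -> : s = (s `^ p) `^ p^-1 by rewrite -powRrM divff// powRr1.
rewrite ge0_ler_powR ?invr_ge0 ?(ltW p0) ?nnegrE ?powR_ge0//.
  by rewrite divr_ge0 ?(ltW C0) ?(ltW q0).
by rewrite ler_pdivrMr// (mulrC _ C).
Qed.

(** Equality would give [theta^(1/p) * v <= v], with [theta > 1] and [v > 0]. *)
Lemma essnorm_mass_seq_neq (v : R) :
  essnorm (Hop p1 (mass_seq late_share)) = v%:E -> essnorm (Hop p1 (mass_seq no_share)) <> v%:E.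
Proof.
move=> h1 h2; have [r r0 hr] := opnorm_mass_positive.
have v0 : 0 < v by apply: lt_le_trans r0 _; rewrite -lee_fin -h2; exact: essnorm_ge.
have tp : 0 < theta `^ p^-1 by rewrite powR_gt0.
have : ((theta `^ p^-1 * v)%:E <= v%:E)%E.
  rewrite -[leRHS]h1; apply: essnorm_ge => N s s0 hs.
  have [N2 hN2] := opnorm_compare s0 hs.
  have := le_trans (essnorm_le_tail p1 N2 (mass_seq no_share)) hN2.
  by rewrite h2 lee_fin powRN mulrC ler_pdivlMr// mulrC.
rewrite lee_fin leNgt => /negP; apply; rewrite ltr_pMl//.
have -> : 1 = 1 `^ p^-1 :> R by rewrite powR1.
by rewrite gt0_ltr_powR ?nnegrE ?invr_gt0// ltW.
Qed.

End coarse_partition.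

(** * Norm equivalence and conclusion *)

Section dyadic_norm.
Context {R : realType} (p : R) (p1 : 1 < p).
Implicit Types (g : nat -> R[i]^o).

Let p0 : 0 < p. Proof. exact: lt_trans p1. Qed.
Let pn0 : p != 0. Proof. by rewrite gt_eqF. Qed.
Let dyadic := fun j : nat => (2 ^ j)%N.
Let dyadic_homo : {homo dyadic : m n / (m < n)%N}.
Proof. by move=> m n mn; rewrite /dyadic ltn_exp2l. Qed.

Let Gd0 g j : 0 <= G p dyadic g j.
Proof. exact: G_ge0. Qed.

Lemma Hop_boundedP g : Hop_bounded p1 g <->
  (ereal_sup (range (fun n => (G p dyadic g n)%:E)) < +oo)%E.
Proof.
split=> [/opnorm_Hop_bounded[r r0 hr]|].
  have [C C0 hC] := dyadic_lower p1.
  apply: le_lt_trans (ltry (C * r `^ p)); apply: ge_ereal_sup => _ [j _ <-].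
  by rewrite lee_fin; apply: hC => //; rewrite hr.
set S := ereal_sup _; have hS j : ((G p dyadic g j)%:E <= S)%E.
  by apply: ereal_sup_ubound; exists j.
case E : S hS => [s| |]// hS _; last by have := hS 0%N.
apply: (@dyadic_bounded _ _ p1 _ s) => [|j]; last by rewrite -lee_fin.
by apply: le_trans (Gd0 g 0%N) _; rewrite -lee_fin.
Qed.

Lemma Hop_norm_equiv : exists c C : R, [/\ 0 < c, 0 < C & forall g, Hop_bounded p1 g ->
  let s := ereal_sup (range (fun n => (G p dyadic g n `^ p^-1)%:E)) in
  (c%:E * s <= opnorm (Hop p1 g))%E /\ (opnorm (Hop p1 g) <= C%:E * s)%E].
Proof.
have [C C0 hC] := dyadic_upper p1; have [K K0 hK] := dyadic_lower p1.
have Kp : 0 < K `^ p^-1 by rewrite powR_gt0.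
exists (K `^ p^-1)^-1, C; split=> [||g hg s]//; first by rewrite invr_gt0.
have [r r0 hr] := opnorm_Hop_bounded hg.
have hGr j : G p dyadic g j `^ p^-1 <= K `^ p^-1 * r.
  have -> : K `^ p^-1 * r = (K * r `^ p) `^ p^-1.
    by rewrite powRM ?powR_ge0 ?(ltW K0)// -powRrM divff// powRr1.
  rewrite ge0_ler_powR ?invr_ge0 ?(ltW p0) ?nnegrE ?Gd0//.
    by rewrite mulr_ge0 ?powR_ge0// ltW.
  by apply: hK => //; rewrite hr.
have hs j : ((G p dyadic g j `^ p^-1)%:E <= s)%E by apply: ereal_sup_ubound; exists j.
have sr : (s <= (K `^ p^-1 * r)%:E)%E.
  by apply: ge_ereal_sup => _ [j _ <-]; rewrite lee_fin.
case E : s sr hs => [t| |] sr hs; [| by [] | by have := hs 0%N].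
have t0 : 0 <= t by apply: le_trans (powR_ge0 _ _) _; rewrite -lee_fin; exact: (hs 0%N).
split; first by rewrite hr -EFinM lee_fin mulrC ler_pdivrMr// mulrC -lee_fin.
rewrite -EFinM; apply: hC => // j.
have -> : G p dyadic g j = (G p dyadic g j `^ p^-1) `^ p by rewrite -powRrM mulVf// powRr1.
by rewrite ge0_ler_powR ?(ltW p0) ?nnegrE ?powR_ge0// -lee_fin.
Qed.

End dyadic_norm.

(** The limit may be [+oo], so [1 + lam] is only taken strictly below it. *)
Lemma eventually_ratio_gt (R : realType) (d : nat -> nat) (l : \bar R) :
  {homo d : m n / (m < n)%N} -> d 0%N = 1%N -> (1 < l)%E ->
  ((d k.+1)%:R / (d k)%:R)%:E @[k --> \oo] --> l ->
  exists (lam : R) (n0 : nat), 0 < lam /\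
    forall n, (n0 <= n)%N -> (1 + lam) * (d n)%:R <= (d n.+1)%:R.
Proof.
move=> dh d0 l1 hl.
have [lam lam0 hlam] : exists2 lam : R, 0 < lam & ((1 + lam)%:E < l)%E.
  case: l l1 {hl} => [r| |]//; last by exists 1 => //; rewrite ltry.
  rewrite lte_fin => r1; exists ((r - 1) / 2); first by rewrite divr_gt0// subr_gt0.
  by rewrite lte_fin; lra.
have [n0 _ h] : \forall k \near \oo, ((1 + lam)%:E < ((d k.+1)%:R / (d k)%:R)%:E)%E.
  exact: (hl _ (open_ereal_gt' hlam)).
exists lam, n0; split=> // n /h /=.
by rewrite lte_fin ltr_pdivlMr ?(blkE dh d0)// => /ltW.
Qed.

Unset Implicit Arguments.

Theorem corollary2 (R : realType) (p : R) (p1 : 1 < p) :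
  let dyadic := fun j : nat => (2 ^ j)%N in
  (forall g : nat -> R[i]^o,
     Hop_bounded p1 g <->
     (ereal_sup (range (fun n => (G p dyadic g n)%:E)) < +oo)%E) /\
  (exists c C : R, [/\ 0 < c, 0 < C &
     forall g : nat -> R[i]^o, Hop_bounded p1 g ->
       let s := ereal_sup (range (fun n => (G p dyadic g n `^ p^-1)%:E)) in
       (c%:E * s <= opnorm (Hop p1 g))%E /\
       (opnorm (Hop p1 g) <= C%:E * s)%E]) /\
  (forall d : nat -> nat,
     {homo d : m n / (m < n)%N} -> d 0%N = 1%N ->
     ((d k.+1)%:R / (d k)%:R @[k --> \oo] --> (1 : R) ->
      forall (g : nat -> R[i]^o) (L : R),
        G p d g n @[n --> \oo] --> L ->
        essnorm (Hop p1 g) = (pi / sin (pi / p) * L `^ p^-1)%:E) /\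
     (forall l : \bar R, (1 < l)%E ->
      ((d k.+1)%:R / (d k)%:R)%:E @[k --> \oo] --> l ->
      ~ exists F : (nat -> R) -> R,
          (forall x : nat -> R, (forall n, 0 <= x n) -> 0 <= F x) /\
          (forall g : nat -> R[i]^o, Hop_bounded p1 g ->
             essnorm (Hop p1 g) = (F (G p d g))%:E))).
Proof.
move=> dyadic; split; first exact: Hop_boundedP.
split; first exact: Hop_norm_equiv.
move=> d dh d0; split=> [d1 g L gL|l lgt1 hl [F [_ hF]]].
  apply/eqP; rewrite eq_le; apply/andP; split.
    exact: (essnorm_upper p1 dh d0 d1 gL).
  exact: (essnorm_lower p1 dh d0 d1 gL).
have [lam [n0 [lam0 hlam]]] := eventually_ratio_gt dh d0 lgt1 hl.
have a1 := late_share_admissible dh d0 lam0 hlam.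
have a2 := no_share_admissible dh d0 lam0.
have h1 := hF _ (mass_seq_bounded p1 dh d0 lam0 a1).
have h2 := hF _ (mass_seq_bounded p1 dh d0 lam0 a2).
(* All block averages equal 1 for both sequences, so [F] receives the same argument twice. *)
have E : G p d (mass_seq p dh d0 (late_share lam n0)) = G p d (mass_seq p dh d0 (@no_share R)).
  by apply/funext => n; rewrite (G_mass_seq p1 dh d0 _ a1) (G_mass_seq p1 dh d0 _ a2).
rewrite E in h1.
by apply: essnorm_mass_seq_neq h1 h2.
Qed.
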